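(* Let $Y$ be a quotient of the Schreier space $S$. Then $Y$ has property-$S(1)$: every normalized weakly null sequence in $Y$ admits a block basis of 1-averages which is equivalent to the unit vector basis of $c_0$.
   Context: Let $c_{00}$ be the space of finitely supported real sequences. For $x=(x_i)\in c_{00}$ set $\|x\|=\max\{\sum_{i=1}^p |x_{k_i}| : p\in\mathbb{N},\ p\le k_1<k_2<\cdots<k_p\}$. The Schreier space $S$ is the completion of $(c_{00},\|\cdot\|)$. $Y$ is a quotient of $S$ if there is a bounded linear operator from $S$ onto $Y$. Given a sequence $(x_n)$, a 1-average of $(x_n)$ is a vector $\lambda\sum_{n\in F}x_n$ with $\lambda>0$ and $F$ a finite nonempty subset of $\mathbb{N}$; a block basis of 1-averages of $(x_n)$ is a sequence $(\lambda_k\sum_{n\in F_k}x_n)_k$ of 1-averages with $\max F_k<\min F_{k+1}$ for all $k$. *)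

(* Defs.v *)
From HB Require Import structures.
From mathcomp Require Import all_boot all_order all_algebra.
From mathcomp Require Import all_classical all_reals all_analysis.
Set Implicit Arguments. Unset Strict Implicit. Unset Printing Implicit Defensive.
Import Order.TTheory GRing.Theory Num.Theory.
Import numFieldNormedType.Exports.
Local Open Scope classical_set_scope.
Local Open Scope ring_scope.

(* Indexing convention: sequences are indexed by nat = {0,1,2,...}; coordinate
   i here corresponds to coordinate i+1 of the paper (which indexes from 1).
   A Schreier-admissible set {k_1<...<k_p} with p <= k_1 (paper indexing)
   becomes: a duplicate-free finite list s with size s <= k.+1 for all k in s. *)
Definition schreier_admissible (s : seq nat) : bool :=
  uniq s && all (fun k => size s <= k.+1)%N s.

Definition schreier_norm (R : realType) (x : nat -> R) : \bar R :=
  ereal_sup [set ((\sum_(k <- s) `|x k|)%:E) | s in [set s | schreier_admissible s]].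

Definition seq_tail (R : realType) (n : nat) (x : nat -> R) : nat -> R :=
  fun i => if (i < n)%N then 0 else x i.

(* The Schreier space S = completion of (c00, schreier_norm), realised as the
   set of real sequences with finite Schreier norm whose tails tend to 0 in
   Schreier norm (these are exactly the Schreier-norm limits of their
   truncations). *)
Definition in_schreier (R : realType) (x : nat -> R) : Prop :=
  (schreier_norm x < +oo)%E /\
  forall eps : R, 0 < eps -> exists N : nat, forall n : nat, (N <= n)%N ->
    (schreier_norm (seq_tail n x) <= eps%:E)%E.

Definition schreier_quotient_map (R : realType) (Y : normedModType R)
    (T : (nat -> R) -> Y) : Prop :=
  (forall (a : R) (x x' : nat -> R), in_schreier x -> in_schreier x' ->
      T (fun i => a * x i + x' i) = a *: T x + T x') /\
  (exists C : R, forall x, in_schreier x ->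
      ((`|T x|)%:E <= C%:E * schreier_norm x)%E) /\
  (forall y : Y, exists x, in_schreier x /\ T x = y).

Definition quotient_of_schreier (R : realType) (Y : normedModType R) : Prop :=
  exists T : (nat -> R) -> Y, schreier_quotient_map T.

Definition weakly_null (R : realType) (Y : normedModType R) (y : nat -> Y) : Prop :=
  forall f : Y -> R,
    (forall (a : R) (u v : Y), f (a *: u + v) = a * f u + f v) ->
    continuous f ->
    (fun n => f (y n)) @ \oo --> (0 : R).

Definition normalized (R : realType) (Y : normedModType R) (y : nat -> Y) : Prop :=
  forall n, `|y n| = 1.

Definition block_basis_of_1_averages (R : realType) (Y : normedModType R)
    (y : nat -> Y) (z : nat -> Y) : Prop :=
  exists (lam : nat -> R) (F : nat -> seq nat),
    (forall k, 0 < lam k) /\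
    (forall k, F k != [::] /\ uniq (F k)) /\
    (forall k i j, i \in F k -> j \in F k.+1 -> (i < j)%N) /\
    (forall k, z k = lam k *: \sum_(n <- F k) y n).

Definition equiv_c0_basis (R : realType) (Y : normedModType R) (z : nat -> Y) : Prop :=
  exists a b : R, 0 < a /\ 0 < b /\
    forall (m : nat) (c : nat -> R),
      a * \big[Num.max/0]_(k < m) `|c k| <= `|\sum_(k < m) c k *: z k| /\
      `|\sum_(k < m) c k *: z k| <= b * \big[Num.max/0]_(k < m) `|c k|.

Definition property_S1 (R : realType) (Y : normedModType R) : Prop :=
  forall y : nat -> Y, normalized y -> weakly_null y ->
    exists z : nat -> Y, block_basis_of_1_averages y z /\ equiv_c0_basis z.

(* Main.v *)
(** Write [t_i] for the image of the unit vector [e_i] under the quotient map. By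
    Baire, every vector [y] is approximated by finite combinations
    [sum_i x_i t_i] with [|x| <= K |y|] in the Schreier norm.  The basis of [S] is
    shrinking, so the dual of [Y] is separable and [y] has a subsequence all of
    whose bounded sums over late index sets are weakly small.  A
    separation/weak* compactness argument then shows that, along a further
    subsequence [u], any lift [x] of [lam * sum_(k in F) u_k] can be cut smoothly
    into essentially disjoint pieces lifting the individual terms [lam * u_k].
    If the sums [sum_(k in F) u_k] stay bounded, [u] itself has an upper
    [c_0]-estimate.  Otherwise take [lam = 1 / |sum_(k in F) u_k|] tiny: the lift
    [x] has few coordinates above a given threshold, so deleting few indices from
    [F] leaves an average of norm at least 1/2 with a flat bounded lift; block
    sequences of flat bounded vectors of [S] have an upper [c_0]-estimate.  A last
    subsequence, almost biorthogonal to norming functionals, gives the lower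
    estimate. *)

Require Import Defs.
From HB Require Import structures.
From mathcomp Require Import all_boot all_order all_algebra.
From mathcomp Require Import all_classical all_reals all_analysis.
From mathcomp Require Import ring lra zify.
Set Implicit Arguments. Unset Strict Implicit. Unset Printing Implicit Defensive.
Import Order.TTheory GRing.Theory Num.Theory.
Import numFieldNormedType.Exports.
Local Open Scope classical_set_scope.
Local Open Scope ring_scope.

(** * Hahn-Banach for sublinear functionals *)

Definition sublinear (R : realType) (V : lmodType R) (q : V -> R) : Prop :=
  (forall x y, q (x + y) <= q x + q y) /\
  (forall t x, 0 < t -> q (t *: x) <= t * q x).

Definition dual_ball (R : realType) (Y : normedModType R) (g : Y -> R) : Prop :=
  (forall (a : R) (u v : Y), g (a *: u + v) = a * g u + g v) /\
  (forall v, `|g v| <= `|v|).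

Section HahnBanach.
Variables (R : realType) (V : lmodType R).
Implicit Types (q : V -> R) (x y u : V).

Lemma sublinear0 q : sublinear q -> q 0 = 0.
Proof.
move=> [_ h]; have := h 2 0 ltac:(lra); have := h (2^-1) 0 ltac:(lra).
by rewrite !scaler0; lra.
Qed.

Lemma sublinearZ q t x : sublinear q -> 0 <= t -> q (t *: x) = t * q x.
Proof.
move=> sq; rewrite le_eqVlt => /predU1P[<-|t0].
  by rewrite scale0r mul0r sublinear0.
have [_ h] := sq; apply/eqP; rewrite eq_le h //=.
have := h t^-1 (t *: x); rewrite invr_gt0 => /(_ t0).
by rewrite scalerA mulVf ?gt_eqF // scale1r ler_pdivlMl.
Qed.

Lemma sublinearN q x : sublinear q -> - q (- x) <= q x.
Proof.
move=> sq; have := sq.1 x (- x); rewrite subrr sublinear0 //; lra.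
Qed.

(** The last two conditions ask only for an element of the target set below the expected value. In
    this loose form the lemma covers shifts along a direction, infima of chains, and the
    Mazur-Orlicz functional. *)
Lemma sublinear_inf (E : V -> set R) :
  (forall x, E x !=set0) -> (forall x, has_lbound (E x)) ->
  (forall x y a b, E x a -> E y b -> exists2 c, E (x + y) c & c <= a + b) ->
  (forall t x a, 0 < t -> E x a -> exists2 c, E (t *: x) c & c <= t * a) ->
  sublinear (fun x => inf (E x)).
Proof.
move=> E0 Elb ED EZ; split=> [x y|t x t0].
  apply/ler_addgt0Pr => e e0.
  have [a Ea ha] := inf_adherent (ltac:(lra) : 0 < e / 2) (conj (E0 x) (Elb x)).
  have [b Eb hb] := inf_adherent (ltac:(lra) : 0 < e / 2) (conj (E0 y) (Elb y)).
  have [c Ec hc] := ED _ _ _ _ Ea Eb.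
  have := ge_inf (Elb _) Ec; lra.
rewrite -ler_pdivrMl //; apply: lb_le_inf; first exact: E0.
move=> a Ea; have [c Ec hc] := EZ _ _ _ t0 Ea.
rewrite ler_pdivrMl //; apply: le_trans hc; exact: ge_inf.
Qed.

(** The infimum over [t >= 0] of [q (x + t *: u) - t * q u] is sublinear and, by [t = 0], lies below
    [q]. Minimality makes it equal to [q], and [t = 1] then gives the inequality. *)
Lemma minimal_sublinear_additive q :
  sublinear q ->
  (forall q', sublinear q' -> (forall x, q' x <= q x) -> q' = q) ->
  forall x u, q x + q u <= q (x + u).
Proof.
move=> sq qmin x u.
pose E x := [set q (x + t *: u) - t * q u | t in [set t : R | 0 <= t]].
have Elb z : has_lbound (E z).
  exists (- q (- z)) => _ [t /= t0 <-].
  have := sq.1 (z + t *: u) (- z).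
  by rewrite addrAC subrr add0r sublinearZ //; lra.
have sE : sublinear (fun x => inf (E x)).
  apply: sublinear_inf => //.
  - by move=> z; exists (q (z + 0 *: u) - 0 * q u), 0 => //=.
  - move=> z w _ _ [t /= t0 <-] [s /= s0 <-].
    exists (q (z + w + (t + s) *: u) - (t + s) * q u).
      by exists (t + s) => //=; lra.
    have := sq.1 (z + t *: u) (w + s *: u).
    by rewrite addrACA scalerDl; lra.
  - move=> r z _ r0 [t /= t0 <-].
    exists (q (r *: z + (r * t) *: u) - (r * t) * q u).
      by exists (r * t) => //=; apply: mulr_ge0 => //; exact: ltW.
    rewrite -scalerA -scalerDr (sublinearZ _ sq (ltW r0)); lra.
have qE : (fun x => inf (E x)) = q.
  apply: qmin => // z; apply: ge_inf => //.
  by exists 0 => //=; rewrite scale0r addr0 mul0r subr0.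
suff : inf (E x) <= q (x + u) - q u by rewrite [inf _](congr1 (@^~ x) qE); lra.
by apply: ge_inf => //; exists 1 => //=; rewrite scale1r mul1r.
Qed.

(** Zorn is applied to the sublinear functionals below [p], ordered downwards, so that a maximal
    element is a pointwise minimal functional. Such a functional is additive, hence linear. *)
Lemma Hahn_Banach_sublinear (p : V -> R) : sublinear p ->
  exists g : V -> R, (forall a u v, g (a *: u + v) = a * g u + g v) /\
    forall x, g x <= p x.
Proof.
move=> sp.
pose T := {q : V -> R | sublinear q /\ forall x, q x <= p x}.
pose mkT q (sq : sublinear q) (qp : forall x, q x <= p x) : T :=
  exist _ q (conj sq qp).
pose rel (q1 q2 : T) := `[< forall x, sval q2 x <= sval q1 x >].
have [||||[q [sq qp]] qmin] := @Zorn T rel.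
- by move=> t; apply/asboolP.
- move=> r s t /asboolP rs /asboolP st; apply/asboolP => x.
  exact: le_trans (st x) (rs x).
- move=> [s ps] [t pt] /asboolP /= st /asboolP /= ts.
  by apply/eq_exist/funext => x; apply/eqP; rewrite eq_le st ts.
- move=> A Atot; have [[q0 Aq0]|nA] := pselect (exists q : T, A q); last first.
    by exists (mkT _ sp (fun=> lexx _)) => s As; case: nA; exists s.
  pose E x := [set sval (q : T) x | q in A].
  (* Every sublinear functional below [p] is at least [- p (- x)] at [x], so infima over chains are
     finite. *)
  have Elb x : has_lbound (E x).
    exists (- p (- x)) => _ [[q [sq qp]] /= _ <-].
    have := sublinearN x sq; have := qp (- x); lra.
  have sE : sublinear (fun x => inf (E x)).
    apply: sublinear_inf => //.
    + by move=> x; exists (sval q0 x); exists q0.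
    + move=> x y _ _ [q1 A1 <-] [q2 A2 <-].
      have [/asboolP h|/asboolP h] := Atot _ _ A1 A2.
        exists (sval q2 (x + y)); first by exists q2.
        by have := (svalP q2).1.1 x y; have := h x; lra.
      exists (sval q1 (x + y)); first by exists q1.
      by have := (svalP q1).1.1 x y; have := h y; lra.
    + move=> t x _ t0 [q Aq <-]; exists (sval q (t *: x)); first by exists q.
      exact: (svalP q).1.2.
  have Ep x : inf (E x) <= p x.
    by apply: le_trans ((svalP q0).2 x); apply: ge_inf => //; exists q0.
  exists (mkT _ sE Ep) => s As; apply/asboolP => x /=.
  by apply: ge_inf => //; exists s.
have addq x u : q (x + u) = q x + q u.
  apply/eqP; rewrite eq_le sq.1 /=; apply: minimal_sublinear_additive => // q' sq' q'q.
  have q'p x' : q' x' <= p x' by exact: le_trans (qp x').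
  have := qmin (mkT _ sq' q'p).
  by move=> /(_ ltac:(exact/asboolP)) [].
have oppq x : q (- x) = - q x.
  by have := addq x (- x); rewrite subrr sublinear0 //; lra.
exists q; split => // a u v; rewrite addq; congr (_ + _).
have [a0|a0] := leP 0 a; first exact: sublinearZ.
by rewrite -[a]opprK scaleNr oppq sublinearZ //; lra.
Qed.

End HahnBanach.

(** * The dual unit ball: separation, norming functionals, weak* cluster points *)

Section DualBall.
Variables (R : realType) (Y : normedModType R).
Implicit Types (g : Y -> R).

Section LinearForm.
Variable g : Y -> R.
Hypothesis gB : dual_ball g.

Lemma dual_ball0 : g 0 = 0.
Proof. by have := gB.2 0; rewrite normr0 normr_le0 => /eqP. Qed.

Lemma dual_ballD u v : g (u + v) = g u + g v.
Proof. by have := gB.1 1 u v; rewrite scale1r mul1r. Qed.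

Lemma dual_ballZ a u : g (a *: u) = a * g u.
Proof. by have := gB.1 a u 0; rewrite !addr0 dual_ball0 addr0. Qed.

Lemma dual_ballN u : g (- u) = - g u.
Proof. by rewrite -scaleN1r dual_ballZ mulN1r. Qed.

Lemma dual_ballB u v : g (u - v) = g u - g v.
Proof. by rewrite dual_ballD dual_ballN. Qed.

Lemma dual_ball_sum (I : Type) (r : seq I) (P : pred I) (F : I -> Y) :
  g (\sum_(i <- r | P i) F i) = \sum_(i <- r | P i) g (F i).
Proof.
by elim/big_rec2 : _ => [|i a b _ <-]; rewrite ?dual_ball0 ?dual_ballD.
Qed.

Lemma dual_ball_le v : g v <= `|v|.
Proof. exact: le_trans (ler_norm _) (gB.2 v). Qed.

Lemma dual_ball_continuous : continuous g.
Proof.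
move=> x; apply/cvgrPdist_le => e e0.
near=> z; rewrite -dual_ballB; apply: le_trans (gB.2 _) _.
near: z; exact: cvgr_dist_le.
Unshelve. all: by end_near. Qed.

End LinearForm.

(* The Mazur-Orlicz form of Hahn-Banach, obtained by extending the sublinear
   functional [v |-> inf_(t >= 0) (|v + sum_j t_j d_j| - e * sum_j t_j)]. *)
Lemma dual_ball_separation (m : nat) (d : nat -> Y) (e : R) :
  (forall t : nat -> R, (forall j, 0 <= t j) ->
     e * \sum_(j < m) t j <= `|\sum_(j < m) t j *: d j|) ->
  exists2 g, dual_ball g & forall j, (j < m)%N -> e <= g (d j).
Proof.
move=> hd.
pose E v := [set `|v + \sum_(j < m) t j *: d j| - e * \sum_(j < m) t j
            | t in [set t : nat -> R | forall j, 0 <= t j]].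
have Elb v : has_lbound (E v).
  exists (- `|v|) => _ [t /= t0 <-].
  have := hd t t0; have := ler_normD (v + \sum_(j < m) t j *: d j) (- v).
  by rewrite addrAC subrr add0r normrN; lra.
have sE : sublinear (fun v => inf (E v)).
  apply: sublinear_inf => //.
  - by move=> v; eexists; exists (fun=> 0) => //=.
  - move=> u v _ _ [t /= t0 <-] [s /= s0 <-].
    eexists; first by exists (fun j => t j + s j) => [j|] /=; [exact: addr_ge0|].
    have -> : \sum_(j < m) (t j + s j) *: d j
        = \sum_(j < m) t j *: d j + \sum_(j < m) s j *: d j.
      by rewrite -big_split /=; apply: eq_bigr => j _; rewrite scalerDl.
    rewrite big_split /= addrACA.
    have := ler_normD (u + \sum_(j < m) t j *: d j) (v + \sum_(j < m) s j *: d j).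
    lra.
  - move=> r v _ r0 [t /= t0 <-].
    eexists; first by exists (fun j => r * t j) => [j|] /=;
      [apply: mulr_ge0 => //; exact: ltW|].
    have -> : \sum_(j < m) (r * t j) *: d j = r *: \sum_(j < m) t j *: d j.
      by rewrite scaler_sumr; apply: eq_bigr => j _; rewrite scalerA.
    by rewrite -mulr_sumr -scalerDr normrZ gtr0_norm // mulrBr mulrCA.
have [g [glin gE]] := Hahn_Banach_sublinear sE.
have gle v : g v <= `|v|.
  apply: le_trans (gE v) _; apply: ge_inf => //.
  exists (fun=> 0) => //=; rewrite !big1 ?mulr0 ?subr0 ?addr0 // => j _.
  by rewrite scale0r.
have g0 : g 0 = 0 by have := glin 1 0 0; rewrite scale1r mul1r add0r; lra.
have gN v : g (- v) = - g v.
  by have := glin (-1) v 0; rewrite scaleN1r !addr0 g0 addr0 mulN1r.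
exists g.
  split=> // v; rewrite ler_norml gle andbT lerNl -gN.
  by apply: le_trans (gle _) _; rewrite normrN.
move=> j jm; rewrite -lerN2 -gN; apply: le_trans (gE _) _; apply: ge_inf => //.
(* Unit weight on [d j] cancels the vector [- d j], leaving the value [- e]. *)
exists (fun i => (i == j)%:R) => /=; first by move=> i; exact: ler0n.
rewrite (bigD1 (Ordinal jm)) //= eqxx scale1r big1 ?addr0; last first.
  by move=> i; rewrite -val_eqE /= => /negPf ->; rewrite scale0r.
rewrite addNr normr0 sub0r (bigD1 (Ordinal jm)) //= eqxx big1 ?addr0 ?mulr1 //.
by move=> i; rewrite -val_eqE /= => /negPf ->.
Qed.

Lemma norming_functional (v : Y) : exists2 g, dual_ball g & g v = `|v|.
Proof.
have [t t0|g gB /(_ 0%N isT) h] := @dual_ball_separation 1 (fun=> v) `|v|.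
  by rewrite !big_ord1 normrZ ger0_norm // mulrC.
by exists g => //; apply/eqP; rewrite eq_le h dual_ball_le.
Qed.

(* Weak* compactness of the dual ball, as a limit along an ultrafilter. *)
Lemma dual_ball_cluster (g_ : nat -> Y -> R) :
  (forall k, dual_ball (g_ k)) ->
  exists2 g, dual_ball g & forall (vs : seq Y) (e : R) (N : nat), 0 < e ->
    exists2 k, (N <= k)%N & forall v, v \in vs -> `|g_ k v - g v| <= e.
Proof.
move=> gB; have [U [UU Uoo]] := @ultraFilterLemma nat \oo _.
(* The values [g_ k v] stay in the compact segment from [- |v|] to [|v|], so the image ultrafilter
   converges. *)
have cv v : exists l : R, g_ k v @[k --> U] --> l.
  pose W : set_system R := g_ k v @[k --> U].
  have WU : UltraFilter W.
    split; first exact: fmap_proper_filter.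
    move=> G GP WG; apply/seteqP; split => // A GA.
    have [//|nA] := in_ultra_setVsetC (fun k => A (g_ k v)) UU.
    have /WG GnA : W (~` A) by [].
    have /filter_ex[x []] : G (A `&` ~` A) by exact: filterI.
    by [].
  have := @segment_compact R (- `|v|) `|v|; rewrite compact_ultra => /(_ W WU).
  case.
    rewrite /W /=; apply: (@filterS _ U _ setT); last exact: filterT.
    move=> k _ /=; rewrite in_itv /= -ler_norml; exact: (gB k).2.
  by move=> l [_ Wl]; exists l.
have [g gl] := choice cv.
exists g.
  split=> [a u v|v].
    have h1 : g_ k (a *: u + v) @[k --> U] --> a * g u + g v.
      rewrite (_ : (fun k => _) = (fun k => a * g_ k u + g_ k v)); last first.
        by apply/funext => k; exact: (gB k).1.
      by apply: cvgD; [apply: cvgM; [exact: cvg_cst|]|]; exact: gl.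
    exact: (cvg_unique _ (gl _) h1).
  rewrite ler_norml; apply/andP; split.
    apply: (cvgr_to_ge (gl v)) => //.
    by apply: nearW => k; have := (gB k).2 v; rewrite ler_norml => /andP[].
  apply: (cvgr_to_le (gl v)) => //.
  by apply: nearW => k; have := (gB k).2 v; rewrite ler_norml => /andP[].
move=> vs e N e0.
(* A finite intersection of [U]-large sets is [U]-large, and [U] refines the filter at infinity;
   hence one index serves all of [vs] and lies past [N]. *)
have : \forall k \near U, (N <= k)%N /\ forall v, v \in vs -> `|g_ k v - g v| <= e.
  apply: filterI; first by apply: Uoo; exact: nbhs_infty_ge.
  elim: vs => [|v vs IH]; first by apply: filterS filterT => k _ v; rewrite in_nil.
  have h : \forall k \near U, `|g_ k v - g v| <= e by exact: cvgr_distC_le e0.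
  by apply: filterS2 IH h => k IH h w; rewrite inE => /predU1P[->|/IH].
by move=> /filter_ex[k [Nk hk]]; exists k.
Qed.

End DualBall.

(** The condition on a new term sees the list of all earlier ones, as gliding-hump constructions
    require. *)
Lemma dependent_selection (A : Type) (P : seq A -> A -> Prop) :
  (forall s, exists a, P s a) -> exists u : nat -> A, forall n, P (mkseq u n) (u n).
Proof.
move=> /choice[f fP].
pose s_ n := iter n (fun s => rcons s (f s)) [::].
exists (fun n => f (s_ n)) => n.
suff -> : mkseq (fun n => f (s_ n)) n = s_ n by exact: fP.
by elim: n => // n IH; rewrite mkseqS IH.
Qed.

Lemma ltn_homo_of_succ (p : nat -> nat) : (forall k, (p k < p k.+1)%N) ->
  {homo p : i j / (i < j)%N}.
Proof. by move=> pS; apply: homo_ltn => [? ? ? h|//]; exact: ltn_trans. Qed.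

(** * Schreier norm bounds in real-valued form, and gluing of blocks *)

Definition schreier_le (R : realType) (x : nat -> R) (B : R) : Prop :=
  forall s, schreier_admissible s -> \sum_(k <- s) `|x k| <= B.

Section Schreier.
Variable R : realType.
Implicit Types (x y z f : nat -> R) (B K : R).

Lemma schreier_le_ge0 x B : schreier_le x B -> 0 <= B.
Proof. by move=> /(_ [::] isT); rewrite big_nil. Qed.

Lemma schreier_le_coord x B k : schreier_le x B -> `|x k| <= B.
Proof. by move=> /(_ [:: k]); rewrite big_seq1; apply. Qed.

Lemma schreier_le_dom x y B :
  (forall k, `|y k| <= `|x k|) -> schreier_le x B -> schreier_le y B.
Proof. by move=> yx xB s /xB; apply: le_trans; apply: ler_sum. Qed.

Lemma schreier_leW x B B' : B <= B' -> schreier_le x B -> schreier_le x B'.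
Proof. by move=> BB' xB s /xB /le_trans; apply. Qed.

Lemma schreier_leD x y B B' : schreier_le x B -> schreier_le y B' ->
  schreier_le (fun i => x i + y i) (B + B').
Proof.
move=> xB yB s sa; apply: le_trans (lerD (xB s sa) (yB s sa)).
by rewrite -big_split /=; apply: ler_sum => k _; exact: ler_normD.
Qed.

Lemma schreier_leZ a x B : schreier_le x B ->
  schreier_le (fun i => a * x i) (`|a| * B).
Proof.
move=> xB s /xB h; under eq_bigr do rewrite normrM.
by rewrite -mulr_sumr; apply: ler_wpM2l.
Qed.

(** An admissible set meeting [[0, q[] has at most [q] elements, so it collects at most [1] from
    [y]. An admissible set missing [[0, q[] sees only [y]. *)
Lemma schreier_le_glue (q : nat) x y K :
  (forall i, (q <= i)%N -> x i = 0) ->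
  (forall i, q%:R * `|y i| <= 1) ->
  schreier_le x K -> schreier_le y (K + 1) ->
  schreier_le (fun i => x i + y i) (K + 1).
Proof.
move=> x0 y1 xK yK s sa.
have [/hasP[k ks kq]|/hasPn h] := boolP (has (fun k => k < q)%N s).
  have sq : (size s <= q)%N.
    by move: sa => /andP[_ /allP/(_ _ ks)] /leq_trans; apply.
  apply: (@le_trans _ _ (\sum_(k <- s) `|x k| + \sum_(k <- s) `|y k|)).
    by rewrite -big_split /=; apply: ler_sum => i _; exact: ler_normD.
  apply: lerD; first exact: xK.
  have q0 : 0 < q%:R :> R by rewrite ltr0n; case: (q) kq.
  apply: (@le_trans _ _ (\sum_(k <- s) q%:R^-1)).
    by apply: ler_sum => i _; rewrite -[q%:R^-1]mulr1 ler_pdivlMl.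
  rewrite big_const_seq count_predT iter_addr addr0 -[_ *+ _]mulr_natl.
  by rewrite ler_pdivrMr // mul1r ler_nat.
rewrite (@eq_big_seq _ _ _ _ _ _ (fun k => `|y k|)); first exact: yK.
by move=> k /h; rewrite -leqNgt => /x0 ->; rewrite add0r.
Qed.

(** At most [q] of the indices lie below [q], where [q] is half their number. Hence [q] of the
    others can be kept, and these form an admissible set. *)
Lemma schreier_le_large_coord x B e (s : seq nat) : schreier_le x B ->
  0 <= e -> uniq s -> (forall k, k \in s -> e <= `|x k|) ->
  ((size s)./2)%:R * e <= B.
Proof.
move=> xB e0 us hs; set q := (size s)./2.
pose s1 := [seq k <- s | (q <= k)%N]; pose s2 := take q s1.
have sz1 : (q <= size s1)%N.
  have : (size [seq k <- s | ~~ (q <= k)%N] <= size (iota 0 q))%N.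
    apply: uniq_leq_size; first exact: filter_uniq.
    by move=> k; rewrite mem_filter mem_iota -ltnNge => /andP[].
  have : (count (fun k => q <= k)%N s + count (fun k => ~~ (q <= k))%N s = size s)%N.
    by rewrite -(count_predC (fun k => q <= k)%N s).
  have : (q.*2 <= size s)%N by rewrite -[leqRHS]odd_double_half leq_addl.
  by rewrite size_iota !size_filter -/q; lia.
have sz2 : size s2 = q by rewrite size_takel.
have s2s k : k \in s2 -> (k \in s) && (q <= k)%N.
  by move=> /mem_take; rewrite mem_filter andbC.
have : \sum_(k <- s2) `|x k| <= B.
  apply: xB; apply/andP; split; first by rewrite take_uniq // filter_uniq.
  by apply/allP => k /s2s /andP[_]; rewrite sz2 => /leqW.
apply: le_trans; rewrite -sz2 mulr_natl -[_ *+ _]addr0 -iter_addr.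
rewrite -(count_predT s2) -big_const_seq big_seq [leRHS]big_seq.
by apply: ler_sum => k /s2s/andP[/hs].
Qed.

(** Blocks are glued from the last to the first. The sum of the later blocks keeps the bound [K + 1]
    at each gluing because the block put in front has norm at most [K]. *)
Lemma schreier_le_blocks (p : nat -> nat) (z : nat -> nat -> R) (c : nat -> R) K n :
  (forall k, (p k <= p k.+1)%N) ->
  (forall k i, (i < p k)%N || (p k.+1 <= i)%N -> z k i = 0) ->
  (forall k i, (p k)%:R * `|z k i| <= 1) ->
  (forall k, schreier_le (z k) K) -> (forall k, `|c k| <= 1) ->
  schreier_le (fun i => \sum_(k < n) c k * z k i) (K + 1).
Proof.
move=> pS zsupp zsup zK c1.
have K0 : 0 <= K by exact: schreier_le_ge0 (zK 0%N).
have cz k i : `|c k * z k i| <= `|z k i| by rewrite normrM ler_piMl.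
(* The induction also carries the vanishing of the tail sum before [p k0] and its flatness, which
   the next gluing uses. *)
suff h l : forall k0, [/\ forall i, (i < p k0)%N ->
      \sum_(k0 <= k < k0 + l) c k * z k i = 0,
    forall i, (p k0)%:R * `|\sum_(k0 <= k < k0 + l) c k * z k i| <= 1 &
    schreier_le (fun i => \sum_(k0 <= k < k0 + l) c k * z k i) (K + 1)].
  have [_ _] := h n 0%N; rewrite add0n => hs s /hs.
  by under eq_bigr do rewrite big_mkord.
elim: l => [|l IH] k0.
  rewrite addn0; split=> [i _|i|s _]; rewrite ?big_geq ?normr0 ?mulr0 //.
  by rewrite big1 ?addr_ge0 // => i _; rewrite big_geq ?normr0.
have [v0 v1 vK] := IH k0.+1; rewrite addSnnS in v0 v1 vK.
have recl i : \sum_(k0 <= k < k0 + l.+1) c k * z k i =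
    c k0 * z k0 i + \sum_(k0.+1 <= k < k0 + l.+1) c k * z k i.
  by rewrite big_ltn // -addSnnS leq_addr.
split=> [i ip|i|].
- by rewrite recl zsupp ?ip // mulr0 v0 ?addr0 //; exact: leq_trans (pS k0).
- rewrite recl; have [ip|pi] := ltnP i (p k0.+1).
    rewrite v0 // addr0; apply: le_trans (zsup k0 i).
    by apply: ler_wpM2l.
  rewrite zsupp ?pi ?orbT // mulr0 add0r; apply: le_trans (v1 i).
  by apply: ler_wpM2r => //; rewrite ler_nat.
- move=> s sa; under eq_bigr do rewrite recl.
  apply: (schreier_le_glue (q := p k0.+1) (K := K)) sa => //.
    by move=> i pi; rewrite zsupp ?pi ?orbT // mulr0.
  exact: schreier_le_dom (cz k0) (zK k0).
Qed.

(** * The unit vector basis of the Schreier space is shrinking *)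

Section Shrinking.
Variables (f : nat -> R) (K e : R).
Let val x q := \sum_(i < q) x i * `|f i|.
Let block x p q := forall i, (i < p)%N || (q <= i)%N -> x i = 0.

Let val_le x q q' : (forall i, 0 <= x i) -> (q <= q')%N -> val x q <= val x q'.
Proof.
move=> x0 qq'; rewrite /val.
rewrite -(big_mkord predT (fun i => x i * `|f i|)) -(big_mkord predT (fun i => x i * `|f i|)).
rewrite (big_cat_nat _ qq') //= lerDl; apply: sumr_ge0 => i _.
by rewrite mulr_ge0.
Qed.

Let valD x y q : val (fun i => x i + y i) q = val x q + val y q.
Proof. by rewrite -big_split; apply: eq_bigr => i _; rewrite mulrDl. Qed.

Hypothesis blocks : forall p, exists z q, [/\ (p <= q)%N, forall i, 0 <= z i,
  block z p q, schreier_le z K & e <= val z q].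

(** Norm bounds and values add up over successive blocks, while the supports are disjoint and the
    sup norm stays at most [K]. Dividing by a large [N] therefore flattens without losing value. *)
Let sum_blocks N p : exists z q, [/\ (p <= q)%N, forall i, 0 <= z i <= K,
  block z p q, schreier_le z (N%:R * K) & N%:R * e <= val z q].
Proof.
have K0 : 0 <= K.
  by have [z [q [_ _ _ /schreier_le_ge0]]] := blocks 0.
elim: N p => [|N IH] p.
  exists (fun=> 0), p; split => //; first by rewrite lexx.
    by move=> s _; rewrite mul0r big1 // => i _; rewrite normr0.
  by rewrite mul0r /val big1 // => i _; rewrite mul0r.
have [z [q [pq z0 zb zK ze]]] := blocks p.
have [y [r [qr y0 yb yK ye]]] := IH q.
have y_ge0 i : 0 <= y i by case/andP: (y0 i).
exists (fun i => z i + y i), r; split.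
- exact: leq_trans qr.
- move=> i; rewrite addr_ge0 //=; have [iq|qi] := ltnP i q.
    rewrite yb ?iq // addr0; apply: le_trans (schreier_le_coord i zK).
    exact: ler_norm.
  by rewrite zb ?qi ?orbT // add0r; case/andP: (y0 i).
- move=> i /orP[ip|ri].
    by rewrite zb ?ip // yb ?addr0 // (leq_trans ip pq).
  by rewrite yb ?ri ?orbT // zb ?addr0 // (leq_trans qr ri) orbT.
- by rewrite -addn1 natrD mulrDl mul1r addrC; exact: schreier_leD.
- rewrite valD -addn1 natrD mulrDl mul1r addrC; apply: lerD => //.
  by apply: le_trans ze _; exact: val_le.
Qed.

Let flat_block (a : R) p : 0 < a -> exists z q, [/\ (p <= q)%N,
  forall i, 0 <= z i, forall i, z i <= a, block z p q & schreier_le z K /\ e <= val z q].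
Proof.
move=> a0; have K0 : 0 <= K.
  by have [z [q [_ _ _ /schreier_le_ge0]]] := blocks 0.
pose N := (Num.truncn (K / a)).+1.
have N0 : 0 < N%:R :> R by rewrite ltr0n.
have Ka : K / N%:R <= a.
  rewrite ler_pdivrMr // mulrC -ler_pdivrMr // ltW //.
  exact: truncnS_gt.
have [z [q [pq z0 zb zK ze]]] := sum_blocks N p.
exists (fun i => N%:R^-1 * z i), q; split => //.
- by move=> i; apply: mulr_ge0; [rewrite invr_ge0 ltW|case/andP: (z0 i)].
- move=> i; apply: le_trans Ka; rewrite mulrC ler_pM2r ?invr_gt0 //.
  by case/andP: (z0 i).
- by move=> i /zb ->; rewrite mulr0.
- split.
    have := schreier_leZ N%:R^-1 zK.
    by rewrite gtr0_norm ?invr_gt0 // mulKf // gt_eqF.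
  rewrite /val; under eq_bigr do rewrite -mulrA.
  by rewrite -mulr_sumr ler_pdivlMl.
Qed.

(** Each further block is flat relative to the end [q] of the preceding one, so gluing keeps the
    norm below [K + 1] while the values accumulate. *)
Let tower (M : nat) (a : R) p : 0 < a -> exists x q, [/\ (p <= q)%N,
  forall i, 0 <= x i, forall i, x i <= a, block x p q &
  schreier_le x (K + 1) /\ M%:R * e <= val x q].
Proof.
have K0 : 0 <= K.
  by have [z [q [_ _ _ /schreier_le_ge0]]] := blocks 0.
elim: M a p => [|M IH] a p a0.
  exists (fun=> 0), p; split => //; first by move=> _; exact: ltW.
  split; first by move=> s _; rewrite big1 ?addr_ge0 // => i _; rewrite normr0.
  by rewrite mul0r /val big1 // => i _; rewrite mul0r.
have [z [q [pq z0 za zb [zK ze]]]] := flat_block p a0.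
(* The bound [1 / (q + 1)] gives the flatness needed for gluing at [q] and stays defined for
   [q = 0]. *)
have [|y [r [qr y0 ya yb [yK ye]]]] := IH (Num.min a (q.+1)%:R^-1) q.
  by rewrite lt_min a0 invr_gt0 ltr0n.
have y1 i : q%:R * `|y i| <= 1.
  rewrite ger0_norm //; have := ya i; rewrite le_min => /andP[_ h].
  apply: (@le_trans _ _ (q.+1%:R * y i)); first by rewrite ler_wpM2r // ler_nat.
  by rewrite -ler_pdivlMl ?ltr0n // mulr1.
exists (fun i => z i + y i), r; split.
- exact: leq_trans qr.
- by move=> i; exact: addr_ge0.
- move=> i; have [iq|qi] := ltnP i q.
    by rewrite yb ?iq // addr0.
  rewrite zb ?qi ?orbT // add0r; have := ya i.
  by rewrite le_min => /andP[].
- move=> i /orP[ip|ri].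
    by rewrite zb ?ip // yb ?addr0 // (leq_trans ip pq).
  by rewrite yb ?ri ?orbT // zb ?addr0 // (leq_trans qr ri) orbT.
- split.
    apply: (schreier_le_glue (q := q)) => //.
    by move=> i qi; rewrite zb ?qi ?orbT.
  rewrite valD -addn1 natrD mulrDl mul1r addrC; apply: lerD => //.
  by apply: le_trans ze _; exact: val_le.
Qed.

Lemma schreier_unbounded_form C : 0 < e ->
  ~ (forall n x B, schreier_le x B -> `|\sum_(i < n) x i * f i| <= C * B).
Proof.
move=> e0 fC.
(* This makes [M * e] exceed [C * (K + 1)], contradicting boundedness of the form on the tower once
   its coordinates are given the signs of [f]. *)
pose M := (Num.truncn (C * (K + 1) / e)).+1.
have [x [q [_ x0 _ _ [xK xM]]]] := tower M 0 (@ltr01 R).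
pose x' i := x i * Num.sg (f i).
have x'K : schreier_le x' (K + 1).
  apply: schreier_le_dom xK => i.
  by rewrite normrM normr_sg; case: (f i != 0); rewrite ?mulr1 ?mulr0.
have := fC q _ _ x'K.
have -> : \sum_(i < q) x' i * f i = val x q.
  by apply: eq_bigr => i _; rewrite /x' -mulrA -normrEsg.
apply/negP; rewrite -ltNge; apply: lt_le_trans (ler_norm _).
apply: lt_le_trans xM; rewrite -ltr_pdivrMr //; exact: truncnS_gt.
Qed.

End Shrinking.

(** If it failed, there would be vectors arbitrarily far out with value above [e]. The absolute
    values of their restrictions to [[a, q[] are the blocks excluded by
    [schreier_unbounded_form]. *)
Lemma schreier_shrinking f C K e : 0 < e ->
  (forall n x B, schreier_le x B -> `|\sum_(i < n) x i * f i| <= C * B) ->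
  exists p, forall x a q, schreier_le x K -> (p <= a)%N ->
    `|\sum_(a <= i < q) x i * f i| <= e.
Proof.
move=> e0 fC; apply: contrapT => /forallNP H.
apply: (@schreier_unbounded_form f K e _ C e0 fC) => p.
have /existsNP[x /existsNP[a /existsNP[q /not_implyP[xK /not_implyP[pa]]]]] := H p.
move=> /negP; rewrite -ltNge => hlt.
have aq : (a <= q)%N.
  have [//|qa] := leqP a q.
  by move: hlt; rewrite (big_geq (ltnW qa)) normr0 ltNge (ltW e0).
exists (fun i => if (a <= i < q)%N then `|x i| else 0), q; split.
- exact: leq_trans pa aq.
- by move=> i; case: ifP.
- move=> i h; case: ifP => // /andP[ai iq]; exfalso; move: h.
  rewrite [(q <= i)%N]leqNgt iq orbF.
  by rewrite ltnNge (leq_trans pa ai).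
- by apply: schreier_le_dom xK => i; case: ifP; rewrite ?normr_id ?normr0.
- apply: ltW; apply: lt_le_trans hlt _.
  apply: le_trans (ler_norm_sum _ _ _) _.
  rewrite -(big_mkord predT (fun i => (if (a <= i < q)%N then `|x i| else 0) * `|f i|)).
  rewrite [leRHS](big_cat_nat _ aq) //= -[leLHS]add0r; apply: lerD.
    by apply: sumr_ge0 => i _; apply: mulr_ge0 => //; case: ifP.
  rewrite big_nat [leRHS]big_nat; apply: ler_sum => i ->.
  by rewrite normrM.
Qed.

End Schreier.

(** When [t i] is the image of the [i]-th unit vector, this is the image of [x] truncated to its
    first [n] coordinates. *)
Definition synth (R : realType) (Y : normedModType R) (t : nat -> Y) (n : nat)
  (x : nat -> R) : Y := \sum_(i < n) x i *: t i.

(** * Approximate lifts through the quotient map *)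

Section Frame.
Variable R : realType.
Implicit Types (x : nat -> R) (B : R).

Let unitv (i : nat) : nat -> R := fun k => (k == i)%:R.
Let trunc (n : nat) x : nat -> R := fun i => if (i < n)%N then x i else 0.

Lemma schreier_normP x B : (schreier_norm x <= B%:E)%E <-> schreier_le x B.
Proof.
split=> [h s sa|xB].
  rewrite -lee_fin; apply: le_trans h.
  by apply: ereal_sup_ubound; exists s.
by apply: ge_ereal_sup => _ [s /= sa <-]; rewrite lee_fin; exact: xB.
Qed.

Lemma in_schreier_finite x B n : schreier_le x B ->
  (forall i, (n <= i)%N -> x i = 0) -> in_schreier x.
Proof.
move=> xB x0; split.
  by move/schreier_normP : xB => /le_lt_trans; apply; rewrite ltry.
move=> e e0; exists n => m nm; apply/schreier_normP => s _.
rewrite big1 ?ltW // => k _; rewrite /seq_tail; case: ltnP => mk.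
  by rewrite normr0.
by rewrite x0 ?normr0 // (leq_trans nm mk).
Qed.

Lemma in_schreier_tail x n : in_schreier x -> in_schreier (seq_tail n x).
Proof.
have dom y : forall k, `|seq_tail n y k| <= `|y k|.
  by move=> k; rewrite /seq_tail; case: ifP; rewrite ?normr0.
move=> [xfin xt]; split.
  apply: le_lt_trans xfin; apply: ge_ereal_sup => _ [s /= sa <-].
  apply: (@le_trans _ _ (\sum_(k <- s) `|x k|)%:E).
    by rewrite lee_fin; apply: ler_sum => k _; exact: dom.
  by apply: ereal_sup_ubound; exists s.
move=> e /xt[N hN]; exists N => m /hN /schreier_normP h; apply/schreier_normP.
apply: schreier_le_dom h => k; rewrite /seq_tail; case: ifP => _ //.
by case: ifP; rewrite ?normr0.
Qed.

Lemma in_schreier_bounded x : in_schreier x ->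
  exists n : nat, schreier_le x n%:R.
Proof.
move=> [xfin _].
have x0 : (0%:E <= schreier_norm x)%E.
  by apply: ereal_sup_ubound; exists [::] => //; rewrite big_nil.
case E : (schreier_norm x) xfin x0 => [r| |] //= _; rewrite lee_fin => r0.
exists (Num.truncn r).+1; apply/schreier_normP; rewrite E lee_fin ltW //.
exact: truncnS_gt.
Qed.

Let unitv_le i : schreier_le (unitv i) 1.
Proof.
move=> s /andP[us _]; rewrite (eq_bigr (fun k => ((k == i) : nat)%:R)); last first.
  by move=> k _; rewrite /unitv normr_nat.
rewrite -natr_sum -[1]/(1%:R) ler_nat -big_mkcond /= sum1_count count_uniq_mem //.
exact: leq_b1.
Qed.

Variable Y : completeNormedModType R.
Variable T : (nat -> R) -> Y.
Hypothesis Tq : schreier_quotient_map T.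

Let TD a x x' : in_schreier x -> in_schreier x' ->
  T (fun i => a * x i + x' i) = a *: T x + T x'.
Proof. exact: Tq.1. Qed.

Let in0 : in_schreier (fun=> 0 : R).
Proof.
apply: (@in_schreier_finite _ 0 0) => // s _.
by rewrite big1 // => k _; rewrite normr0.
Qed.

Let T0 : T (fun=> 0) = 0.
Proof.
have := TD 1 in0 in0; rewrite scale1r.
rewrite [X in T X](_ : _ = (fun=> 0)); last by apply/funext => i; rewrite mulr0 addr0.
by move=> /eqP; rewrite -subr_eq subrr eq_sym => /eqP.
Qed.

Let unitv_in i : in_schreier (unitv i).
Proof.
apply: (in_schreier_finite (unitv_le i) (n := i.+1)) => k ik.
by rewrite /unitv gtn_eqF.
Qed.

Let trunc_le n x B : schreier_le x B -> schreier_le (trunc n x) B.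
Proof. by apply: schreier_le_dom => k; rewrite /trunc; case: ifP; rewrite ?normr0. Qed.

Let trunc_in n x B : schreier_le x B -> in_schreier (trunc n x).
Proof.
move=> /(trunc_le n) h; apply: (in_schreier_finite h (n := n)) => i ni.
by rewrite /trunc ltnNge ni.
Qed.

Let T_trunc n x B : schreier_le x B ->
  T (trunc n x) = \sum_(i < n) x i *: T (unitv i).
Proof.
move=> xB; elim: n => [|n IH].
  by rewrite big_ord0 -[RHS]T0; congr T; apply/funext.
rewrite big_ord_recr /= -IH addrC -TD //; last exact: trunc_in xB.
congr T; apply/funext => i; rewrite /trunc /unitv ltnS leq_eqVlt.
by case: eqVneq => [->|_] /=; rewrite ?ltnn ?mulr1 ?addr0 // mulr0 add0r.
Qed.

Let T_bounded : exists2 C, 0 < C & forall x B, in_schreier x -> schreier_le x B ->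
  `|T x| <= C * B.
Proof.
have [C hC] := Tq.2.1; exists (`|C| + 1) => [|x B xin xB]; first exact: ltr_wpDl.
rewrite -lee_fin; apply: le_trans (hC x xin) _.
have x0 : (0%:E <= schreier_norm x)%E.
  by apply: ereal_sup_ubound; exists [::] => //; rewrite big_nil.
apply: (@le_trans _ _ ((`|C| + 1)%:E * schreier_norm x)%E).
  apply: lee_wpmul2r => //; rewrite lee_fin; have := ler_norm C; lra.
rewrite EFinM; apply: lee_wpmul2l; last exact/schreier_normP.
by rewrite lee_fin; have := normr_ge0 C; lra.
Qed.

(** The Baire half of the open mapping theorem: the images of the balls of integer radius cover [Y],
    so the closure of one of them contains a ball, centred at some [y0]. *)
Let T_almost_open : exists n (r : R), 0 < r /\ forall v, `|v| < r ->
  forall d, 0 < d -> exists x, [/\ in_schreier x, schreier_le x n%:R & `|v - T x| <= d].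
Proof.
pose A (n : nat) := [set T x | x in [set x | in_schreier x /\ schreier_le x n%:R]].
have [n /denseNE] : exists n, ~ dense (~` closure (A n)).
  apply: contrapT => /forallNP H.
  have /(_ setT) : dense (\bigcap_n (~` closure (A n))).
    apply: Baire => n; split; first by apply: closed_openC; exact: closed_closure.
    exact: contrapT (H n).
  case; [by exists 0|exact: openT|move=> y [_ hy]].
  have [x [xin xy]] := Tq.2.2 y; have [n xn] := in_schreier_bounded xin.
  by apply: (hy n I); apply: subset_closure; exists x.
move=> [U [[y0 [oU Uy0]] UA]].
have sUA : U `<=` closure (A n).
  move=> u Uu; apply: contrapT => nu.
  by have := UA; rewrite -subset0 => /(_ u); apply.
have /nbhs_ballP[r /= r0 rU] : nbhs y0 U by exact: open_nbhs_nbhs.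
have approx v d : `|v| < r -> 0 < d -> exists x, [/\ in_schreier x,
    schreier_le x n%:R & `|y0 + v - T x| <= d].
  move=> vr d0; have /sUA/(_ (ball (y0 + v) d)) : U (y0 + v).
    by apply: rU; rewrite -ball_normE /= opprD addrA subrr add0r normrN.
  case; first exact: nbhsx_ballx.
  move=> _ [[x [xin xn] <-]]; rewrite -ball_normE /= => /ltW h.
  by exists x.
exists (n + n)%N, r; split=> // v vr d d0.
(* Subtracting a lift near [y0] from a lift near [y0 + v] moves the centre to the origin and doubles
   the radius [n]. *)
have [x [xin xn xv]] := approx v (d / 2) vr ltac:(lra).
have [x' [x'in x'n x'v]] := approx 0 (d / 2) ltac:(by rewrite normr0) ltac:(lra).
exists (fun i => (-1) * x' i + x i); split.
- have xx' : schreier_le (fun i => -1 * x' i + x i) (`|-1| * n%:R + n%:R).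
    by apply: schreier_leD => //; exact: schreier_leZ.
  split; first by move/schreier_normP : xx' => /le_lt_trans; apply; rewrite ltry.
  move=> e e0; have [N hN] := xin.2 (e / 2) ltac:(lra).
  have [N' hN'] := x'in.2 (e / 2) ltac:(lra).
  exists (maxn N N') => m; rewrite geq_max.
  move=> /andP[/hN/schreier_normP h /hN'/schreier_normP h'].
  apply/schreier_normP.
  have := schreier_leD (schreier_leZ (-1) h') h; rewrite normrN1 mul1r.
  rewrite (_ : e / 2 + e / 2 = e); last by lra.
  apply: schreier_le_dom => k; rewrite /seq_tail; case: ifP => // _.
  by rewrite mulr0 addr0.
- rewrite natrD; apply: schreier_leD => //.
  by have := schreier_leZ (-1) x'n; rewrite normrN1 mul1r.
- rewrite TD // scaleN1r.
  have -> : v - (- T x' + T x) = (y0 + v - T x) - (y0 + 0 - T x').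
    rewrite addr0 opprD opprK opprB [y0 + v]addrC -2!addrA; congr (v + _).
    by rewrite [RHS]addrCA [y0 + _]addrC subrK addrC.
  by apply: le_trans (ler_normB _ _) _; lra.
Qed.

Lemma schreier_quotient_frame : exists (t : nat -> Y) (C K : R),
  [/\ 0 < K,
   (forall n x B, schreier_le x B -> `|synth t n x| <= C * B) &
   (forall y d, 0 < d -> exists n x, schreier_le x (K * `|y|) /\
      `|y - synth t n x| <= d)].
Proof.
have [C C0 hC] := T_bounded; have [n [r [r0 hr]]] := T_almost_open.
(* The summand [1] keeps [K] positive even when [n = 0]. *)
exists (T \o unitv), C, (2 * n%:R / r + 1); split => //.
- by rewrite ltr_wpDl // divr_ge0 ?mulr_ge0 // ltW.
- move=> m x B xB; rewrite /synth -(T_trunc m xB); apply: hC; first exact: trunc_in xB.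
  exact: trunc_le.
move=> y d d0; have [->|y0] := eqVneq y 0.
  exists 0%N, (fun=> 0); rewrite /synth normr0 mulr0 big_ord0 subr0 normr0 ltW //; split=> //.
  by move=> s _; rewrite big1 // => k _; rewrite normr0.
have ny : 0 < `|y| by rewrite normr_gt0.
(* Dividing by [a] brings [y] to norm [r / 2], inside the ball where approximate lifts exist. *)
pose a := 2 * `|y| / r; have a0 : 0 < a by rewrite divr_gt0 // mulr_gt0.
have [||x [xin xn xy]] := hr (a^-1 *: y) _ (d / (2 * a)).
- rewrite normrZ gtr0_norm ?invr_gt0 // /a invf_div.
  have -> : r / (2 * `|y|) * `|y| = r / 2 by field; rewrite gt_eqF.
  by lra.
- by rewrite divr_gt0 // mulr_gt0.
(* The allowance [d] is halved between the approximation error and the discarded tail, both after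
   scaling back by [a]. *)
have [N hN] := xin.2 (d / (2 * a * C))
  ltac:(by apply: divr_gt0 => //; apply: mulr_gt0 => //; apply: mulr_gt0).
exists N, (fun i => a * x i); split.
  have := schreier_leZ a xn; apply: schreier_leW.
  rewrite gtr0_norm //.
  have -> : a * n%:R = 2 * n%:R / r * `|y| by rewrite /a; ring.
  by rewrite [leRHS]mulrDl mul1r lerDl.
have := hN N (leqnn N) => /schreier_normP /(hC _ _ (in_schreier_tail N xin)) ht.
have -> : synth (T \o unitv) N (fun i => a * x i) = a *: T (trunc N x).
  rewrite /synth (T_trunc N xn) scaler_sumr; apply: eq_bigr => i _.
  by rewrite scalerA.
have Tx : T x = T (seq_tail N x) + T (trunc N x).
  rewrite -[T (seq_tail N x)]scale1r -TD; [|exact: in_schreier_tail|exact: trunc_in xn].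
  congr T; apply/funext => i; rewrite /seq_tail /trunc mul1r.
  by case: ifP; rewrite ?add0r ?addr0.
have -> : y - a *: T (trunc N x) = a *: (a^-1 *: y - T x) + a *: T (seq_tail N x).
  rewrite scalerBr scalerA divff ?gt_eqF // scale1r Tx scalerDr opprD -!addrA.
  by congr (_ + _); rewrite [RHS]addrCA addNr addr0.
apply: le_trans (ler_normD _ _) _; rewrite !(normrZ a) (gtr0_norm a0).
have h1 : a * `|a^-1 *: y - T x| <= d / 2.
  by rewrite -ler_pdivlMl // mulrC -mulrA -invfM.
have h2 : a * `|T (seq_tail N x)| <= d / 2.
  rewrite -ler_pdivlMl //; apply: le_trans ht _.
  by rewrite le_eqVlt; apply/orP; left; apply/eqP; field; rewrite !gt_eqF.
by apply: le_trans (lerD h1 h2) _; lra.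
Qed.

End Frame.

(** * Finite sums and geometric bounds *)

Section Sums.
Variable R : realType.

Lemma ler_sum_uniq (I : eqType) (F s : seq I) (u : I -> R) :
  uniq F -> uniq s -> {subset F <= s} -> (forall j, 0 <= u j) ->
  \sum_(j <- F) u j <= \sum_(j <- s) u j.
Proof.
move=> uF us Fs u0.
rewrite (perm_big [seq j <- s | j \in F]) /=; last first.
  apply: uniq_perm => //; first exact: filter_uniq.
  by move=> j; rewrite mem_filter; case: (boolP (j \in F)) => // /Fs ->.
rewrite big_filter big_mkcond; apply: ler_sum => j _.
by case: ifP.
Qed.

Lemma sum_half_pow_le (F : seq nat) (m : nat) : uniq F ->
  (forall j, j \in F -> (m <= j)%N) ->
  \sum_(j <- F) 2^-1 ^+ j <= 2 * 2^-1 ^+ m :> R.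
Proof.
move=> uF Fm; pose N := (\max_(j <- F) j)%N.
apply: (@le_trans _ _ (\sum_(j <- iota m N.+1) 2^-1 ^+ j)).
  apply: ler_sum_uniq => //; first exact: iota_uniq.
    move=> j jF; rewrite mem_iota Fm //= ltn_addl // ltnS.
    exact: (@leq_bigmax_seq _ F xpredT id j).
suff -> n : \sum_(j <- iota m n) 2^-1 ^+ j = 2 * 2^-1 ^+ m - 2 * 2^-1 ^+ (m + n) :> R.
  by rewrite gerBl mulr_ge0 // exprn_ge0.
elim: n => [|n IH]; first by rewrite big_nil addn0 subrr.
by rewrite -addn1 iotaD big_cat /= IH big_seq1 addnA addn1 exprS; lra.
Qed.

Lemma half_pow_small (e : R) : 0 < e -> exists m, forall n, (m <= n)%N ->
  2^-1 ^+ n <= e.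
Proof.
move=> e0; exists (Num.truncn e^-1).+1 => n mn.
rewrite exprVn invf_ple ?posrE ?exprn_gt0 //; apply: ltW.
apply: lt_le_trans (truncnS_gt _) _; rewrite -natrX ler_nat.
by apply: leq_trans mn _; apply: ltnW; exact: ltn_expl.
Qed.

Lemma half_pow_gt0 n : 0 < 2^-1 ^+ n :> R.
Proof. by rewrite exprn_gt0. Qed.

End Sums.

#[local] Hint Resolve half_pow_gt0 : core.

(* Bounded sums over late sets of indices are weakly null, not just the terms. *)
Definition uniformly_weakly_null (R : realType) (Y : normedModType R) (y : nat -> Y) :=
  forall (g : Y -> R) (M e : R), dual_ball g -> 0 < e ->
  exists m, forall (F : seq nat) (lam : R), uniq F ->
    (forall j, j \in F -> (m <= j)%N) -> 0 <= lam <= 1 ->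
    `|lam *: \sum_(j <- F) y j| <= M -> `|g (lam *: \sum_(j <- F) y j)| <= e.

(** * Algebra of finite combinations of the [t i] *)

Section Synth.
Variables (R : realType) (Y : normedModType R) (t : nat -> Y).
Local Notation T := (synth t).

Lemma dual_ball_synth g n x : dual_ball g -> g (T n x) = \sum_(i < n) x i * g (t i).
Proof.
by move=> gB; rewrite dual_ball_sum //; apply: eq_bigr => i _; rewrite dual_ballZ.
Qed.

(** Both sides sum over the indices below [n] and [p]. This lets a partial image be read as the full
    image of truncated coefficients, so that averages of partial images become multipliers of
    [x]. *)
Lemma synth_cut n p x : T n (fun i => if (i < p)%N then x i else 0) =
  T p (fun i => if (i < n)%N then x i else 0).
Proof.
have h m r : T m (fun i => if (i < r)%N then x i else 0) =
    \sum_(i < m + r | (i < m)%N && (i < r)%N) x i *: t i.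
  rewrite /synth (big_ord_widen (m + r)
    (fun i => (if (i < r)%N then x i else 0) *: t i)) ?leq_addr //.
  rewrite big_mkcondr; apply: eq_bigr => i _.
  by case: ifP => //; rewrite scale0r.
by rewrite !h addnC; apply: eq_bigl => i; rewrite andbC.
Qed.

Lemma synthZ a n x : T n (fun i => a * x i) = a *: T n x.
Proof. by rewrite /synth scaler_sumr; apply: eq_bigr => i _; rewrite scalerA. Qed.

Lemma synth_sum (I : Type) (r : seq I) (P : pred I) n (x : I -> nat -> R) :
  T n (fun i => \sum_(k <- r | P k) x k i) = \sum_(k <- r | P k) T n (x k).
Proof. by rewrite exchange_big /=; apply: eq_bigr => i _; rewrite scaler_suml. Qed.

Lemma synthB n x y : T n (fun i => x i - y i) = T n x - T n y.
Proof. by rewrite -sumrB; apply: eq_bigr => i _; rewrite scalerBl. Qed.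

Lemma synth_widen n m x : (n <= m)%N -> (forall i, (n <= i)%N -> x i = 0) ->
  T m x = T n x.
Proof.
move=> nm x0; rewrite /synth [RHS](big_ord_widen m (fun i => x i *: t i)) //.
rewrite [RHS]big_mkcond; apply: eq_bigr => i _; case: ltnP => // /x0 ->.
by rewrite scale0r.
Qed.

End Synth.

(** * Separability of the dual, and uniformly weakly null subsequences *)

Section Quotient.
Variables (R : realType) (Y : normedModType R) (t : nat -> Y) (C K : R).
Hypothesis K0 : 0 < K.
Hypothesis tC : forall n x B, schreier_le x B -> `|synth t n x| <= C * B.
Hypothesis tK : forall y d, 0 < d -> exists n x, schreier_le x (K * `|y|) /\
      `|y - synth t n x| <= d.

Local Notation T := (synth t).

Lemma frame_shrinking g B e : dual_ball g -> 0 < e ->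
  exists p, forall x n m, schreier_le x B -> (p <= n <= m)%N ->
    `|g (T m x) - g (T n x)| <= e.
Proof.
move=> gB e0.
have [n x B' /(tC n) h|p hp] := @schreier_shrinking R (fun i => g (t i)) C B e e0.
  by rewrite -(dual_ball_synth t n x gB); apply: le_trans h; exact: gB.2.
exists p => x n m xB /andP[pn nm]; have := hp x n m xB pn; congr (`| _ | <= _).
rewrite !dual_ball_synth // -!(big_mkord predT (fun i => x i * g (t i))).
by rewrite [in RHS](@big_cat_nat _ _ _ n 0 m) //= [RHS]addrC addKr.
Qed.

(** By shrinking, a functional is determined on lifts from the unit ball, up to a small error, by
    finitely many values [g (t i)]. Rounding these to rationals leaves countably many classes, and
    one representative per class is kept. *)
Lemma dual_ball_separable : exists G : nat -> Y -> R,
  (forall l, dual_ball (G l)) /\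
  forall g e, dual_ball g -> 0 < e ->
    exists l, forall v, `|g v - G l v| <= e * `|v|.
Proof.
have zB : dual_ball (fun _ : Y => 0 : R).
  by split=> [a u v|v]; rewrite ?mulr0 ?addr0 ?normr0.
pose form (a : seq rat) n (x : nat -> R) := \sum_(i < n) x i * ratr (nth 0 a i).
pose P (ak : seq rat * nat) (g : Y -> R) := dual_ball g /\
  forall n x, schreier_le x 1 -> `|g (T n x) - form ak.1 n x| <= ak.2.+1%:R^-1.
have /choice[f fP] : forall ak, exists h : Y -> R,
    dual_ball h /\ ((exists g, P ak g) -> P ak h).
  move=> ak; have [[g Pg]|nP] := pselect (exists g, P ak g).
    by exists g; split => //; exact: Pg.1.
  by exists (fun=> 0).
exists (fun l => if unpickle l is Some ak then f ak else fun=> 0); split.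
  by move=> l; case: unpickle => // ak; exact: (fP ak).1.
move=> g e gB e0.
(* Vectors [v] lift with norm about [K * |v|], hence the division by [K]. The precision
   [1 / (k + 1) = 2 * d] pays for head and tail, and two members of one class differ by at most
   [4 * d]. *)
pose e' := e / K; have e'0 : 0 < e' by rewrite divr_gt0.
pose k := Num.truncn (2 / e'); pose d : R := (2 * k.+1%:R)^-1.
have d0 : 0 < d by rewrite invr_gt0 mulr_gt0.
have kd : k.+1%:R^-1 = d + d :> R by rewrite /d; field.
have ke : d + d + (d + d) <= e'.
  rewrite -kd; have : k.+1%:R^-1 <= e' / 2 :> R.
    rewrite -[e' / 2]invf_div lef_pV2 ?posrE ?divr_gt0 //.
    by apply: ltW; exact: truncnS_gt.
  by move=> h; rewrite [leRHS]splitr; exact: lerD.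
clearbody d; have [p hp] := frame_shrinking 1 gB d0.
have /choice[q hq] : forall i, exists q : rat, `|g (t i) - ratr q| <= d / p.+1%:R.
  move=> i; have dp : 0 < d / p.+1%:R by rewrite divr_gt0.
  have [|q] := @rat_in_itvoo R (g (t i) - d / p.+1%:R) (g (t i) + d / p.+1%:R).
    by rewrite ltrBlDr -addrA ltrDl addr_gt0.
  rewrite in_itv /= => /andP[/ltW h1 /ltW h2]; exists q.
  by rewrite ler_distlC h1 h2.
pose a := mkseq q p.
have Pg : P (a, k) g.
  split=> // n x x1 /=.
  have small m : (m <= p)%N -> `|g (T m x) - form a m x| <= d.
    move=> mp; rewrite dual_ball_synth // /form -sumrB.
    apply: le_trans (ler_norm_sum _ _ _) _.
    apply: (@le_trans _ _ (\sum_(i < m) d / p.+1%:R)).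
      apply: ler_sum => i _; rewrite -mulrBr nth_mkseq; last exact: leq_trans mp.
      rewrite normrM -[leRHS]mul1r; apply: ler_pM => //.
      exact: schreier_le_coord.
    rewrite sumr_const card_ord -[_ *+ _]mulr_natr mulrAC ler_pdivrMr // ler_pM2l //.
    by rewrite ler_nat; exact: leqW.
  rewrite kd; have [np|pn] := leqP n p.
    by apply: le_trans (small _ np) _; lra.
  have -> : form a n x = form a p x.
    rewrite /form -!(big_mkord predT (fun i => x i * ratr (nth 0 a i))).
    rewrite (big_cat_nat _ (ltnW pn)) //= -[RHS]addr0; congr (_ + _).
    rewrite big_nat big1 // => i /andP[pi _].
    by rewrite nth_default ?size_mkseq // raddf0 mulr0.
  have -> : g (T n x) - form a p x = (g (T n x) - g (T p x)) + (g (T p x) - form a p x).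
    by rewrite addrA subrK.
  apply: le_trans (ler_normD _ _) _; apply: lerD; last exact: small.
  by apply: hp => //; rewrite leqnn ltnW.
exists (pickle (a, k)); rewrite pickleK => v.
have [fB /(_ (ex_intro _ g Pg)) [_ Pf]] := fP (a, k).
have close n x : schreier_le x 1 -> `|g (T n x) - f (a, k) (T n x)| <= e'.
  move=> x1; have h1 := Pg.2 n x x1; have h2 := Pf n x x1.
  rewrite /= kd in h1 h2; rewrite distrC in h2.
  apply: le_trans ke; apply: le_trans (lerD h1 h2); apply: le_trans (ler_normD _ _).
  by rewrite addrA subrK.
have [->|v0] := eqVneq v 0.
  by rewrite (dual_ball0 gB) (dual_ball0 fB) subrr !normr0 mulr0.
have Kv : 0 < K * `|v| by rewrite mulr_gt0 // normr_gt0.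
apply/ler_addgt0Pr => r r0.
have [n [x [xv hx]]] := tK v (ltac:(lra) : 0 < r / 2).
have /(close n) : schreier_le (fun i => (K * `|v|)^-1 * x i) 1.
  by have := schreier_leZ (K * `|v|)^-1 xv; rewrite gtr0_norm ?invr_gt0 // mulVf ?gt_eqF.
rewrite synthZ.
rewrite (dual_ballZ gB) (dual_ballZ fB) -mulrBr normrM gtr0_norm ?invr_gt0 // ler_pdivrMl //.
have -> : K * `|v| * e' = e * `|v| by rewrite /e'; field; rewrite gt_eqF.
move=> hTx.
have h1 := le_trans (gB.2 _) hx; have h2 := le_trans (fB.2 _) hx.
rewrite (dual_ballB gB) in h1; rewrite (dual_ballB fB) in h2.
have -> : g v - f (a, k) v = (g v - g (T n x)) + (g (T n x) - f (a, k) (T n x))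
   - (f (a, k) v - f (a, k) (T n x)) by lra.
apply: le_trans (ler_normB _ _) _.
have := ler_normD (g v - g (T n x)) (g (T n x) - f (a, k) (T n x)).
lra.
Qed.

(** The [n]-th term is chosen so that the first [n + 1] functionals of the dense family are at most
    [2^-n] on it. Late sums are then small for each of them, and the norm bound [M] transfers this
    to any [g] by density. *)
Lemma uniformly_weakly_null_subsequence (y : nat -> Y) : weakly_null y ->
  exists iota : nat -> nat, (forall k, (iota k < iota k.+1)%N) /\
    uniformly_weakly_null (y \o iota).
Proof.
move=> yw; have [G [GB Gd]] := dual_ball_separable.
have sel (s : seq nat) : exists a, (forall b, b \in s -> (b < a)%N) /\
    forall l, (l <= size s)%N -> `|G l (y a)| <= 2^-1 ^+ size s.
  suff : \forall a \near \oo, (forall b, b \in s -> (b < a)%N) /\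
    forall l, (l <= size s)%N -> `|G l (y a)| <= 2^-1 ^+ size s.
    by move=> /filter_ex.
  apply: filterI.
    elim: s => [|b s IH]; first by near=> a => b; rewrite in_nil.
    near=> a => c; rewrite inE => /predU1P[->|].
      by near: a; exact: nbhs_infty_gt.
    by move: c; near: a.
  have h l : \forall a \near \oo, `|G l (y a)| <= 2^-1 ^+ size s.
    have := yw (G l) (GB l).1 (dual_ball_continuous (GB l)).
    by move=> /cvgr0_norm_le; apply.
  suff : forall m, \forall a \near \oo, forall l, (l <= m)%N ->
      `|G l (y a)| <= 2^-1 ^+ size s by apply.
  elim=> [|m IH].
    by near=> a => l; rewrite leqn0 => /eqP->; near: a.
  near=> a => l; rewrite leq_eqVlt => /predU1P[->|].
    by near: a.
  by rewrite ltnS; move: l; near: a; exact: IH.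
have [iota hi] := dependent_selection sel.
have mem k n : (k < n)%N -> iota k \in mkseq iota n.
  by move=> kn; apply/mapP; exists k => //; rewrite mem_iota.
exists iota; split=> [k|g M e gB e0]; first by apply: (hi k.+1).1; exact: mem.
have [l hl] := Gd g (e / (2 * (`|M| + 1))) gB
  ltac:(apply: divr_gt0 => //; apply: mulr_gt0 => //; exact: ltr_wpDl).
have [m hm] := half_pow_small (ltac:(lra) : 0 < e / 4).
exists (maxn l m) => F lam uF Fm /andP[l0 l1] FM.
set v := lam *: _.
have h1 : `|g v - G l v| <= e / 2.
  apply: le_trans (hl v) _.
  have : `|v| <= `|M| + 1 by apply: le_trans FM _; have := ler_norm M; lra.
  have M1 : 0 < `|M| + 1 by exact: ltr_wpDl.
  move=> /(ler_wpM2l (ltac:(by rewrite divr_ge0 ?mulr_ge0 ?(ltW M1) // ltW) :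
    0 <= e / (2 * (`|M| + 1)))).
  move/le_trans; apply; rewrite le_eqVlt; apply/orP; left; apply/eqP.
  by field; rewrite gt_eqF.
have h2 : `|G l v| <= e / 2.
  rewrite /v dual_ballZ // dual_ball_sum // normrM ger0_norm //.
  apply: le_trans (_ : 1 * \sum_(j <- F) 2^-1 ^+ j <= _).
    apply: ler_pM => //; apply: le_trans (ler_norm_sum _ _ _) _.
    rewrite big_seq [leRHS]big_seq; apply: ler_sum => j jF.
    have := (hi j).2 l; rewrite size_mkseq; apply.
    by apply: leq_trans (Fm j jF); exact: leq_maxl.
  rewrite mul1r; apply: le_trans (sum_half_pow_le _ (m := m) uF _) _.
    by move=> j /Fm; apply: leq_trans; exact: leq_maxr.
  by have := hm m (leqnn m); lra.
by have := ler_normD (g v - G l v) (G l v); rewrite subrK; lra.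
Unshelve. all: by end_near. Qed.

End Quotient.

(** * Cutting lifts of sums *)

Section Cut.
Variables (R : realType) (Y : normedModType R) (t : nat -> Y) (C : R).
Hypothesis tC : forall n x B, schreier_le x B -> `|synth t n x| <= C * B.
Local Notation T := (synth t).

(** Either some convex combination of the partial images from [m] to [m + k] is close to [s], or
    Hahn-Banach separates all of them from [s]. In the first case the same combination of the
    indicators of [[0, m + j[] is the ramp [phi]. *)
Lemma cut_or_separate m k n (x : nat -> R) (s : Y) (e : R) : 0 < e ->
  (exists phi : nat -> R, [/\ forall i, 0 <= phi i <= 1,
     forall i, (i < m)%N -> phi i = 1, forall i, (m + k <= i)%N -> phi i = 0 &
     `|T n (fun i => phi i * x i) - s| <= e]) \/
  (exists2 g, dual_ball g & forall j, (j <= k)%N ->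
     e <= g (T (m + j) (fun i => if (i < n)%N then x i else 0) - s)).
Proof.
move=> e0.
pose d j := T (m + j) (fun i => if (i < n)%N then x i else 0) - s.
have [[c [c0 hc]]|H] := pselect (exists c : nat -> R, (forall j, 0 <= c j) /\
    `|\sum_(j < k.+1) c j *: d j| < e * \sum_(j < k.+1) c j); last first.
  right; have [c c0|g gB hg] := @dual_ball_separation R Y k.+1 d e.
    by rewrite leNgt; apply/negP => hc; apply: H; exists c.
  by exists g.
left; set w := \sum_(j < k.+1) c j in hc.
have w0 : 0 < w by rewrite -(pmulr_rgt0 _ e0); exact: le_lt_trans hc.
have step i j : 0 <= (if (i < m + j)%N then c j else 0) <= c j.
  by case: ifP => _; rewrite ?c0 lexx.
exists (fun i => w^-1 * \sum_(j < k.+1) (if (i < m + j)%N then c j else 0)); split.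
- move=> i; apply/andP; split.
    apply: mulr_ge0; first by rewrite invr_ge0 ltW.
    apply: sumr_ge0 => j _.
    by case/andP: (step i j).
  rewrite ler_pdivrMl // mulr1; apply: ler_sum => j _.
  by case/andP: (step i j).
- move=> i im; rewrite (eq_bigr (fun j : 'I_k.+1 => c j)) ?mulVf ?gt_eqF // => j _.
  by rewrite ltn_addr.
- move=> i ki; rewrite big1 ?mulr0 // => j _; rewrite ltnNge (leq_trans _ ki) //.
  by rewrite leq_add2l -ltnS.
- suff -> :
      T n (fun i => w^-1 * (\sum_(j < k.+1) (if (i < m + j)%N then c j else 0)) * x i) - s
      = w^-1 *: \sum_(j < k.+1) c j *: d j.
    by rewrite normrZ gtr0_norm ?invr_gt0 // ler_pdivrMl // mulrC ltW.
  have -> : (fun i => w^-1 * (\sum_(j < k.+1) (if (i < m + j)%N then c j else 0)) * x i) =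
     (fun i => w^-1 * \sum_(j < k.+1) (c j * (if (i < m + j)%N then x i else 0))).
    apply/funext => i; rewrite -mulrA mulr_suml; congr (_ * _).
    by apply: eq_bigr => j _; case: ifP; rewrite ?mul0r ?mulr0.
  rewrite synthZ synth_sum.
  have -> : s = w^-1 *: \sum_(j < k.+1) c j *: s.
    by rewrite -scaler_suml scalerA mulVf ?scale1r ?gt_eqF.
  rewrite -scalerBr -sumrB; congr (_ *: _); apply: eq_bigr => j _.
  by rewrite synthZ synth_cut -scalerBr.
Qed.

(* If cutting failed for every [m'], the separating functionals would cluster
   at some [g] whose value on the lift [x] is, up to small errors, both that on
   the head [s] of the sum (the rest of the sum being weakly small) and larger
   than it by [e], because [g] barely sees the tail of [x]. *)
Lemma cut_lift (y : nat -> Y) (B : R) (m : nat) (e : R) :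
  uniformly_weakly_null y -> (forall j, `|y j| <= 1) -> 0 < e ->
  exists m', (m < m')%N /\ forall F lam n x, uniq F -> 0 <= lam <= 1 ->
    schreier_le x B -> `|T n x - lam *: \sum_(j <- F) y j| <= e / 4 ->
    (forall j, j \in F -> (j <= m)%N || (m' <= j)%N) ->
    exists phi : nat -> R, [/\ forall i, 0 <= phi i <= 1,
     forall i, (i < m)%N -> phi i = 1, forall i, (m' <= i)%N -> phi i = 0 &
     `|T n (fun i => phi i * x i) - lam *: \sum_(j <- F | (j <= m)%N) y j| <= e].
Proof.
move=> yw y1 e0; apply: contrapT => /forallNP H.
pose s F lam := lam *: \sum_(j <- F | (j <= m)%N) y j.
have bad k : exists a : (seq nat * R) * (nat * (nat -> R)) * (Y -> R),
    let F := a.1.1.1 in let lam := a.1.1.2 in let n := a.1.2.1 in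
    let x := a.1.2.2 in let g := a.2 in
    [/\ uniq F /\ 0 <= lam <= 1, schreier_le x B,
      `|T n x - lam *: \sum_(j <- F) y j| <= e / 4,
      forall j, j \in F -> (j <= m)%N || (m + k.+1 <= j)%N &
      dual_ball g /\ forall j, (j <= k)%N ->
        e <= g (T (m + j) (fun i => if (i < n)%N then x i else 0) - s F lam)].
  have := H (m + k.+1)%N; rewrite addnS ltnS leq_addr => /not_andP[//|].
  move=> /existsNP[F /existsNP[lam /existsNP[n /existsNP[x]]]].
  move=> /not_implyP[uF /not_implyP[hlam /not_implyP[xB
    /not_implyP[hx /not_implyP[hF hphi]]]]].
  have [[phi [h1 h2 h3 h4]]|[g gB hg]] := cut_or_separate m k n x (s F lam) e0.
    case: hphi; exists phi; split=> // i ki; apply: h3; exact: ltnW.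
  by exists ((F, lam), (n, x), g).
have {bad} /choice[a ha] := bad.
have [g gB hg] := @dual_ball_cluster R Y (fun k => (a k).2)
  (fun k => let: And5 _ _ _ _ h := ha k in h.1).
have e16 : 0 < e / 16 by lra.
have [p hp] := frame_shrinking tC B gB e16.
(* The bound is the one available for the remainder [r]: [C * B] for the lifted vector, [e / 4] for
   the lifting error, [m + 1] for the head. *)
have [m1 hm1] := yw g (C * B + e / 4 + m.+1%:R) _ gB e16.
(* [D] counts the terms on which [g] and its approximant are compared: [q] coordinates of size at
   most [|B|] and [m + 1] vectors [y j]. The total error is then [e / 16]. *)
pose q := (m + p)%N; pose D := q%:R * `|B| + m.+1%:R.
have D0 : 0 < D by rewrite ltr_wpDl // mulr_ge0.
pose vs := map t (iota 0 q) ++ map y (iota 0 m.+1).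
have tvs i : (i < q)%N -> t i \in vs.
  by move=> iq; rewrite mem_cat; apply/orP; left; apply: map_f; rewrite mem_iota.
have yvs j : (j <= m)%N -> y j \in vs.
  by move=> jm; rewrite mem_cat; apply/orP; right; apply: map_f; rewrite mem_iota.
have [k Nk hk] := hg vs (e / 16 / D) (maxn p m1) ltac:(by rewrite divr_gt0).
move: Nk; rewrite geq_max => /andP[pk m1k].
have [] := ha k; case: (a k) hk => [[[F lam] [n x]] gk] /= hk.
move=> [uF lam01] xB hx hF [gkB /(_ p pk)].
rewrite -/q; set x' := (fun i => if (i < n)%N then x i else 0) => hgk.
have x'B : schreier_le x' B.
  by apply: schreier_le_dom xB => i; rewrite /x'; case: ifP; rewrite ?normr0.
have /andP[lam0 lam1] := lam01.
have Fm_le (u : nat -> R) : (forall j, 0 <= u j) ->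
    \sum_(j <- F | (j <= m)%N) u j <= \sum_(j <- iota 0 m.+1) u j.
  move=> u0; rewrite -big_filter; apply: ler_sum_uniq => //.
  - exact: filter_uniq.
  - exact: iota_uniq.
  - by move=> j; rewrite mem_filter mem_iota => /andP[].
have dT : `|gk (T q x') - g (T q x')| <= q%:R * `|B| * (e / 16 / D).
  rewrite (dual_ball_synth t q x' gkB) (dual_ball_synth t q x' gB) -sumrB.
  apply: le_trans (ler_norm_sum _ _ _) _.
  apply: (@le_trans _ _ (\sum_(i < q) `|B| * (e / 16 / D))).
    apply: ler_sum => i _; rewrite -mulrBr normrM; apply: ler_pM => //.
      apply: le_trans (schreier_le_coord i x'B) _; exact: ler_norm.
    by apply: hk; exact: tvs.
  by rewrite sumr_const card_ord -[_ *+ _]mulr_natl mulrA.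
have ds : `|gk (s F lam) - g (s F lam)| <= m.+1%:R * (e / 16 / D).
  rewrite /s (dual_ballZ gkB) (dual_ballZ gB) (dual_ball_sum gkB) (dual_ball_sum gB).
  rewrite -mulrBr -sumrB normrM ger0_norm //.
  apply: le_trans (_ : 1 * \sum_(j <- F | (j <= m)%N) (e / 16 / D) <= _).
    apply: ler_pM => //; apply: le_trans (ler_norm_sum _ _ _) _.
    by apply: ler_sum => j jm; apply: hk; exact: yvs.
  rewrite mul1r; apply: le_trans (Fm_le (fun=> e / 16 / D) _) _.
    by move=> _; rewrite divr_ge0 // ltW.
  by rewrite big_const_seq count_predT iter_addr addr0 size_iota mulr_natl.
have err : q%:R * `|B| * (e / 16 / D) + m.+1%:R * (e / 16 / D) = e / 16.
  by rewrite -mulrDl mulrC divfK // gt_eqF.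
have tail : `|g (T n x) - g (T q x')| <= e / 16.
  have -> : T n x = T (q + n) x'.
    rewrite (@synth_widen _ _ t n (q + n) x') ?leq_addl //; last first.
      by move=> i ni; rewrite /x' ltnNge ni.
    by apply: eq_bigr => i _; rewrite /x' ltn_ord.
  by apply: hp => //; rewrite leq_addr /q leq_addl.
pose r := lam *: \sum_(j <- [seq j <- F | (m < j)%N]) y j.
have Fsr : lam *: \sum_(j <- F) y j = s F lam + r.
  rewrite /s /r -scalerDr big_filter (bigID (fun j => (j <= m)%N)) /=.
  by congr (_ *: (_ + _)); apply: eq_bigl => j; rewrite ltnNge.
have s_le : `|s F lam| <= m.+1%:R.
  rewrite normrZ ger0_norm //; apply: le_trans (_ : 1 * \sum_(j <- F | (j <= m)%N) 1 <= _).
    apply: ler_pM => //; apply: le_trans (ler_norm_sum _ _ _) _.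
    by apply: ler_sum.
  rewrite mul1r; apply: le_trans (Fm_le (fun=> 1) _) _ => //.
  by rewrite big_const_seq count_predT iter_addr addr0 size_iota.
have gr : `|g r| <= e / 16.
  apply: hm1 => //; first exact: filter_uniq.
    move=> j; rewrite mem_filter => /andP[mj /hF]; rewrite leqNgt mj /= => h.
    by apply: leq_trans h; rewrite addnS ltnW // ltnS (leq_trans m1k) // leq_addl.
  rewrite (_ : lam *: _ = T n x - (T n x - lam *: \sum_(j <- F) y j) - s F lam); last first.
    by rewrite subKr Fsr [s _ _ + _]addrC addrK.
  apply: le_trans (ler_normB _ _) _; apply: lerD => //.
  apply: le_trans (ler_normB _ _) _; apply: lerD => //; exact: tC.
have glift := le_trans (gB.2 _) hx.
rewrite Fsr (dual_ballB gB) (dual_ballD gB) in glift.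
rewrite (dual_ballB gkB) in hgk.
(* The errors total three times [e / 16] plus [e / 4], which is less than the separation gap [e]. *)
move: dT ds tail gr glift hgk err.
rewrite !ler_norml => /andP[? ?] /andP[? ?] /andP[? ?] /andP[? ?] /andP[? ?].
lra.
Qed.

(* Along a subsequence the cuts of a lift of [lam * sum_(j in F) u_j] take place
   in the consecutive windows [[p_k, p_(k+1)[], whatever [F] is. *)
Lemma cut_lift_subsequence (y : nat -> Y) (B : R) (e : nat -> R) :
  uniformly_weakly_null y -> (forall j, `|y j| <= 1) -> (forall k, 0 < e k) ->
  exists p : nat -> nat, (forall k, (p k < p k.+1)%N) /\
  forall k F lam n x, uniq F -> 0 <= lam <= 1 ->
    schreier_le x B -> `|T n x - lam *: \sum_(j <- F) y (p j)| <= e k / 4 ->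
    exists phi : nat -> R, [/\ forall i, 0 <= phi i <= 1,
     forall i, (i < p k)%N -> phi i = 1, forall i, (p k.+1 <= i)%N -> phi i = 0 &
     `|T n (fun i => phi i * x i) - lam *: \sum_(j <- F | (j <= k)%N) y (p j)| <= e k].
Proof.
move=> yw y1 e0.
have /choice[f hf] := fun km : nat * nat => cut_lift B km.2 yw y1 (e0 km.1).
(* One sequence serves both as indices into [y] and as window endpoints; consecutive values are a
   threshold [m] and its [m'], so indices in the image of [p] avoid the gap between them. *)
pose p := fix p k := if k is k'.+1 then f (k', p k') else 0%N.
have pS k : (p k < p k.+1)%N by exact: (hf (k, p k)).1.
have p_le : {mono p : i j / (i <= j)%N} by exact/leq_mono/ltn_homo_of_succ.
exists p; split => // k F lam n x uF lam01 xB hx.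
have := (hf (k, p k)).2 (map p F) lam n x; rewrite !big_map /=.
have -> : \sum_(j <- F | (p j <= p k)%N) y (p j) = \sum_(j <- F | (j <= k)%N) y (p j).
  by apply: eq_bigl => j; rewrite p_le.
apply => //.
- rewrite map_inj_uniq // => i j pij; apply/eqP.
  by rewrite eqn_leq -(p_le i j) -(p_le j i) pij leqnn.
- move=> _ /mapP[j _ ->]; rewrite p_le -[f _]/(p k.+1) p_le.
  by case: leqP.
Qed.

End Cut.

(** * Averages with flat lifts *)

Section Flat.
Variables (R : realType) (Y : normedModType R) (t : nat -> Y) (K : R).
Hypothesis tK : forall y d, 0 < d -> exists n x, schreier_le x (K * `|y|) /\
      `|y - synth t n x| <= d.
Local Notation T := (synth t).
Variables (u : nat -> Y) (p : nat -> nat).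
Hypothesis u1 : forall j, `|u j| <= 1.
Hypothesis pS : forall k, (p k < p k.+1)%N.
Hypothesis cut : forall k F lam n x, uniq F -> 0 <= lam <= 1 ->
    schreier_le x K -> `|T n x - lam *: \sum_(j <- F) u j| <= 2^-1 ^+ k / 4 ->
    exists phi : nat -> R, [/\ forall i, 0 <= phi i <= 1,
     forall i, (i < p k)%N -> phi i = 1, forall i, (p k.+1 <= i)%N -> phi i = 0 &
     `|T n (fun i => phi i * x i) - lam *: \sum_(j <- F | (j <= k)%N) u j| <= 2^-1 ^+ k].

Let p_lt := ltn_homo_of_succ pS.
Let p_le : {mono p : i j / (i <= j)%N}. Proof. exact: leq_mono. Qed.
Let p_ge k : (k <= p k)%N.
Proof. by elim: k => // k IH; exact: leq_ltn_trans (pS k). Qed.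

(* The windows [[p_(k-1), p_(k+1)[] of the indices [k] of a given parity are
   pairwise disjoint, so each large coordinate of [x] spoils at most two [k]. *)
Let spoiled_le x a (F : seq nat) (W : nat) :
  schreier_le x K -> 0 < a -> K / a < W%:R -> uniq F ->
  (forall k, k \in F -> (0 < k)%N /\
     exists i, (p k.-1 <= i < p k.+1)%N /\ a <= `|x i|) ->
  (size F <= 4 * W)%N.
Proof.
move=> xK a0 aW uF hF.
have /choice[w hw] : forall k, exists i, k \in F ->
    [/\ (0 < k)%N, (p k.-1 <= i < p k.+1)%N & a <= `|x i|].
  move=> k; case: (boolP (k \in F)) => [/hF[k0 [i [hi ai]]]|_].
    by exists i.
  by exists 0%N.
have half (b : bool) : (size [seq k <- F | odd k == b] <= 2 * W)%N.
  set G := [seq k <- F | odd k == b].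
  have GF k : k \in G -> k \in F /\ odd k = b.
    by rewrite mem_filter => /andP[/eqP ? ?].
  have lt k k' : k \in G -> k' \in G -> (k < k')%N -> (w k < w k')%N.
    move=> /GF[kF ko] /GF[k'F k'o] kk'.
    have [k0 /andP[_ h2] _] := hw k kF; have [k'0 /andP[h1 _] _] := hw k' k'F.
    apply: leq_trans h2 _; apply: leq_trans h1; rewrite p_le.
    have : k.+1 != k' by apply/eqP => kk; move: k'o; rewrite -kk /= ko; case: (b).
    by move: kk' k'0; lia.
  have uw : uniq (map w G).
    rewrite map_inj_in_uniq; first exact: filter_uniq.
    move=> k k' kG k'G wk; case: (ltngtP k k') => // h.
      by have := lt _ _ kG k'G h; rewrite wk ltnn.
    by have := lt _ _ k'G kG h; rewrite wk ltnn.
  have := schreier_le_large_coord xK (ltW a0) uw; rewrite size_map.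
  rewrite -ler_pdivlMr // => /(_ _)/le_lt_trans/(_ aW); rewrite ltr_nat => h.
  have : ((size G)./2 < W)%N.
    apply: h => _ /mapP[k /GF[kF _] ->]; by have [] := hw k kF.
  by rewrite -(odd_double_half (size G)); case: odd; lia.
have := half true; have := half false; rewrite !size_filter.
have := count_predC (fun k => odd k == true) F.
rewrite (@eq_count _ (predC _) (fun k => odd k == false)); last by move=> k /=; case: odd.
by lia.
Qed.

Section Pieces.
Variables (F : seq nat) (lam : R) (mx n : nat) (x : nat -> R) (phi : nat -> nat -> R).
Hypotheses (uF : uniq F) (Fmx : forall k, k \in F -> (0 < k <= mx)%N).
Hypothesis phi01 : forall k i, 0 <= phi k i <= 1.
Hypothesis phi1 : forall k i, (i < p k)%N -> phi k i = 1.
Hypothesis phi0 : forall k i, (k <= mx)%N -> (p k.+1 <= i)%N -> phi k i = 0.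
Hypothesis phiX : forall k i, (mx < k)%N -> phi k i = 1.
Hypothesis phiT : forall k, (k <= mx)%N ->
  `|T n (fun i => phi k i * x i) - lam *: \sum_(j <- F | (j <= k)%N) u j| <= 2^-1 ^+ k.

(** The ramp [phi k] descends on [[p k, p k.+1[], so for [0 < k <= mx] this difference is a bump on
    [[p k.-1, p k.+1[]; the bumps telescope to at most [1]. *)
Let dphi k i := phi k i - phi k.-1 i.

Let dphi_ge0 k i : 0 <= dphi k i.
Proof.
case: k => [|k]; first by rewrite /dphi subrr.
rewrite subr_ge0 /=; have /andP[h0 h1] := phi01 k i.
have [h|h] := ltnP i (p k.+1); first by rewrite (phi1 h).
have [kmx|mxk] := leqP k mx; last by rewrite (phiX _ mxk) (phiX _ (leqW mxk)).
by rewrite (phi0 kmx h); case/andP: (phi01 k.+1 i).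
Qed.

Let sum_dphi (G : seq nat) i : uniq G -> {subset G <= F} ->
  0 <= \sum_(k <- G) dphi k i <= 1.
Proof.
move=> uG GF; apply/andP; split; first by apply: sumr_ge0.
apply: (@le_trans _ _ (\sum_(k <- iota 1 mx) dphi k i)).
  apply: ler_sum_uniq => //; first exact: iota_uniq.
  by move=> k /GF/Fmx; rewrite mem_iota add1n ltnS.
have -> : \sum_(k <- iota 1 mx) dphi k i = phi mx i - phi 0 i.
  elim: mx => [|m IH]; first by rewrite big_nil subrr.
  by rewrite -(addn1 m) iotaD big_cat /= IH big_seq1 add1n addn1 /dphi /=; lra.
by have /andP[? ?] := phi01 mx i; have /andP[? ?] := phi01 0 i; lra.
Qed.

(** The heads of the sum at [k] and [k.-1] differ by [lam *: u k], and the two cut errors add up to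
    [2^-k + 2^-(k-1)]. *)
Let piece k : k \in F ->
  `|lam *: u k - T n (fun i => dphi k i * x i)| <= 3 * 2^-1 ^+ k.
Proof.
move=> kF; have /andP[k0 kmx] := Fmx kF.
have h1 := phiT kmx; have h2 := phiT (leq_trans (leq_pred k) kmx).
have -> : (fun i => dphi k i * x i) = (fun i => phi k i * x i - phi k.-1 i * x i).
  by apply/funext => i; rewrite mulrBl.
rewrite synthB.
have -> : lam *: u k = lam *: \sum_(j <- F | (j <= k)%N) u j
    - lam *: \sum_(j <- F | (j <= k.-1)%N) u j.
  rewrite -scalerBr; congr (_ *: _); apply/eqP; rewrite eq_sym subr_eq; apply/eqP.
  rewrite (bigID (fun j => j == k)) /=; congr (_ + _).
    rewrite (eq_bigl (fun j => j == k)); last first.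
      by move=> j; case: eqVneq => [->|]; rewrite ?leqnn ?andbF.
    by rewrite -big_filter filter_pred1_uniq // big_seq1.
  apply: eq_bigl => j; rewrite andbC -ltn_neqAle.
  by rewrite -[in LHS](prednK k0) ltnS.
rewrite distrC.
set A := T _ _ in h1 *; set B := T n _ in h2 *.
set a := lam *: _ in h1 *; set b := lam *: _ in h2 *.
have -> : A - B - (a - b) = (A - a) - (B - b).
  rewrite !opprB -!addrA; congr (_ + _).
  by rewrite [LHS]addrC [LHS]addrAC [LHS]addrC.
apply: le_trans (ler_normB _ _) _.
have -> : 3 * 2^-1 ^+ k = 2^-1 ^+ k + 2^-1 ^+ k.-1 :> R.
  by rewrite -{1 2 3}(prednK k0) exprS; lra.
exact: lerD.
Qed.

(** Only bumps whose window contains no coordinate above [a] are kept. Their sum times [x] vanishes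
    at every large coordinate and still lifts the sum over the kept indices. *)
Lemma assemble_pieces (a : R) (m0 : nat) :
  0 <= a -> (0 < m0)%N -> (forall k, k \in F -> (m0 <= k)%N) ->
  let G := [seq k <- F | ~~ has (fun i => a < `|x i|) (index_iota (p k.-1) (p k.+1))] in
  exists x' : nat -> R, [/\ forall i, (i < p m0.-1)%N || (n <= i)%N -> x' i = 0,
    forall i, `|x' i| <= `|x i|, forall i, `|x' i| <= a &
    `|lam *: \sum_(j <- G) u j - T n x'| <= 6 * 2^-1 ^+ m0].
Proof.
move=> a0 m0_gt0 Fm0 G.
have uG : uniq G by exact: filter_uniq.
have GF : {subset G <= F} by move=> k; rewrite mem_filter => /andP[].
pose x' i := if (i < n)%N then \sum_(k <- G) dphi k i * x i else 0.
have x'x i : `|x' i| <= `|x i|.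
  rewrite /x'; case: ifP => _; last by rewrite normr0.
  rewrite -mulr_suml normrM; have /andP[h0 h1] := sum_dphi i uG GF.
  by rewrite ger0_norm // ler_piMl.
have out k i : (k <= mx)%N -> (0 < k)%N -> ~~ (p k.-1 <= i < p k.+1)%N -> dphi k i = 0.
  move=> kmx k0; rewrite negb_and -ltnNge -leqNgt => /orP[h|h]; rewrite /dphi.
    rewrite !phi1 ?subrr //; apply: leq_trans h _.
    by rewrite p_le leq_pred.
  rewrite !phi0 ?subrr //; first exact: leq_trans (leq_pred k) kmx.
  by rewrite prednK //; apply: leq_trans h; rewrite ltnW.
exists x'; split => //.
- move=> i /orP[h|h]; last by rewrite /x' ltnNge h.
  rewrite /x'; case: ifP => // _; rewrite big_seq big1 // => k kG.
  have /andP[k0 kmx] := Fmx (GF _ kG).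
  rewrite out ?mul0r // negb_and -ltnNge (leq_trans h) // p_le.
  by move: (Fm0 _ (GF _ kG)) => {h}; lia.
- move=> i; have [h|h] := leP `|x i| a; first exact: le_trans h.
  rewrite /x'; case: ifP => _; last by rewrite normr0.
  rewrite big_seq big1 ?normr0 // => k kG.
  have /andP[k0 kmx] := Fmx (GF _ kG).
  rewrite out ?mul0r //; move: kG; rewrite mem_filter => /andP[/hasPn hn _].
  apply/negP => hi; have /hn : i \in index_iota (p k.-1) (p k.+1) by rewrite mem_index_iota.
  by rewrite h.
have -> : T n x' = \sum_(k <- G) T n (fun i => dphi k i * x i).
  rewrite -synth_sum; apply: eq_bigr => i _.
  by rewrite /x' ltn_ord.
rewrite scaler_sumr -sumrB; apply: le_trans (ler_norm_sum _ _ _) _.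
apply: (@le_trans _ _ (\sum_(k <- G) 3 * 2^-1 ^+ k)).
  rewrite big_seq [leRHS]big_seq; apply: ler_sum => k /GF; exact: piece.
rewrite -mulr_sumr (_ : 6 = 3 * 2); last by lra.
rewrite -mulrA; apply: ler_wpM2l => //; apply: sum_half_pow_le => // k /GF.
exact: Fm0.
Qed.

End Pieces.

Lemma flat_average (q : nat) (a e : R) : 0 < a -> 0 < e -> 0 <= K ->
  (forall (M : R) m0, exists F, [/\ uniq F, forall j, j \in F -> (m0 <= j)%N &
     M < `|\sum_(j <- F) u j|]) ->
  exists F lam q' x, [/\ [/\ F != [::], uniq F &
      forall j, j \in F -> (q <= j < q')%N],
    0 < lam /\ 2^-1 <= `|lam *: \sum_(j <- F) u j|,
    (q <= q')%N /\ (forall i, (i < q)%N || (q' <= i)%N -> x i = 0),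
    schreier_le x K /\ forall i, `|x i| <= a &
    `|lam *: \sum_(j <- F) u j - T q' x| <= e].
Proof.
move=> a0 e0 K0 unb.
(* At most [4 * W] indices are spoiled, each costing norm at most [1], while the chosen sum has norm
   above [8 * W]; the kept part retains at least half. *)
pose W := (Num.truncn (K / a)).+1; have aW : K / a < W%:R by exact: truncnS_gt.
have [m1 hm1] := half_pow_small (ltac:(lra) : 0 < e / 6).
(* The lift starts at [p m0.-1], which is at least [q] since [p k >= k]. *)
pose m0 := (maxn m1 q).+1.
have [F [uF Fm0 FM]] := unb (8 * W%:R) m0.
set N := `|_| in FM.
have W1 : 1 <= W%:R :> R by rewrite -[1]/(1%:R) ler_nat.
have N0 : 0 < N by lra.
pose lam := N^-1; have lam0 : 0 < lam by rewrite invr_gt0.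
have lam1 : lam <= 1 by rewrite invf_le1 //; lra.
have nF : `|lam *: \sum_(j <- F) u j| = 1.
  by rewrite normrZ gtr0_norm // mulVf ?gt_eqF.
pose mx := (\max_(j <- F) j)%N.
have Fmx k : k \in F -> (0 < k <= mx)%N.
  move=> kF; rewrite (leq_trans _ (Fm0 k kF)) //=.
  exact: (@leq_bigmax_seq _ F xpredT id k).
(* This precision meets the requirement of every cut with [k <= mx]. *)
have [n [x [xK hx]]] := tK (lam *: \sum_(j <- F) u j)
  (ltac:(by rewrite divr_gt0) : 0 < 2^-1 ^+ mx / 4 :> R).
rewrite nF mulr1 in xK.
have /choice[phi hphi] : forall k, exists ph : nat -> R,
  [/\ forall i, 0 <= ph i <= 1, forall i, (i < p k)%N -> ph i = 1,
    (mx < k)%N -> forall i, ph i = 1 &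
    (k <= mx)%N -> (forall i, (p k.+1 <= i)%N -> ph i = 0) /\
     `|T n (fun i => ph i * x i) - lam *: \sum_(j <- F | (j <= k)%N) u j| <= 2^-1 ^+ k].
  move=> k; have [kmx|mxk] := leqP k mx; last first.
    (* Beyond [mx] the constant ramp keeps all the differences [dphi k] nonnegative. *)
    by exists (fun=> 1); split=> // i; rewrite ler01 lexx.
  have [||||ph [h1 h2 h3 h4]] := @cut k F lam n x => //.
  - by rewrite ltW.
  - rewrite distrC; apply: le_trans hx _; rewrite ler_pM2r ?invr_gt0 //.
    by rewrite ler_wiXn2l // invf_le1 //; lra.
  by exists ph.
have [|||||x' [x'0 x'x x'a x'T]] := @assemble_pieces F lam mx n x phi uF Fmx
  _ _ _ _ _ a m0 (ltW a0) isT Fm0.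
- by move=> k; have [] := hphi k.
- by move=> k; have [] := hphi k.
- by move=> k i kmx; have [_ _ _ /(_ kmx)[h _]] := hphi k; exact: h.
- by move=> k i mxk; have [_ _ h _] := hphi k; exact: h.
- by move=> k kmx; have [_ _ _ /(_ kmx)[]] := hphi k.
pose bad k := has (fun i => a < `|x i|) (index_iota (p k.-1) (p k.+1)).
pose G := [seq k <- F | ~~ bad k]; rewrite -/G in x'T.
have GF : {subset G <= F} by move=> k; rewrite mem_filter => /andP[].
have bad_le : (size [seq k <- F | bad k] <= 4 * W)%N.
  apply: (@spoiled_le x a) => //; first exact: filter_uniq.
  move=> k; rewrite mem_filter => /andP[/hasP[i hi ai] /Fmx/andP[k0 _]]; split=> //.
  by exists i; rewrite -mem_index_iota; split=> //; exact: ltW.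
have nG : 2^-1 <= `|lam *: \sum_(j <- G) u j|.
  have FG : \sum_(j <- F) u j = \sum_(j <- F | bad j) u j + \sum_(j <- F | ~~ bad j) u j.
    by rewrite (bigID bad).
  have b_le : `|\sum_(j <- F | bad j) u j| <= 4 * W%:R.
    rewrite -big_filter; apply: le_trans (ler_norm_sum _ _ _) _.
    apply: le_trans (ler_sum _ (fun j _ => u1 j)) _.
    by rewrite big_const_seq count_predT iter_addr addr0 -natrM ler_nat.
  rewrite normrZ gtr0_norm // mulrC ler_pdivlMr // /G big_filter.
  have := ler_normD (\sum_(j <- F | bad j) u j) (\sum_(j <- F | ~~ bad j) u j).
  by move: FG FM; rewrite /N => ->; lra.
have qp : (q <= p m0.-1)%N by apply: leq_trans (p_ge _); exact: leq_maxr.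
exists G, lam, (n + q + mx.+1)%N, x'; split.
- split; [|exact: filter_uniq|].
    apply/eqP => G0; move: nG; rewrite G0 big_nil scaler0 normr0.
    by rewrite leNgt invr_gt0 ltr0n.
  move=> j /GF jF; have /andP[_ jmx] := Fmx j jF.
  rewrite (leq_trans _ (Fm0 j jF)) /=; last by apply: leqW; exact: leq_maxr.
  by rewrite ltn_addl // ltnS.
- by [].
- split; first by rewrite -addnA addnCA leq_addr.
  move=> i /orP[h|h]; apply: x'0; first by rewrite (leq_trans h qp).
  by rewrite (leq_trans _ h) ?orbT // -addnA leq_addr.
- by split => //; exact: schreier_le_dom xK.
- rewrite (@synth_widen _ _ t n) -?addnA ?leq_addr //; last first.
    by move=> i h; apply: x'0; rewrite h orbT.
  apply: le_trans x'T _; have := hm1 m0 (leqW (leq_maxl _ _)); lra.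
Qed.

End Flat.

(** * Upper and lower [c_0]-estimates *)

Section C0.
Variables (R : realType) (Y : normedModType R) (z : nat -> Y) (b : R).
Hypothesis zb : forall m (c : nat -> R), (forall k, `|c k| <= 1) ->
  `|\sum_(k < m) c k *: z k| <= b.

(** Testing the upper estimate on the signs of [g (z k)] bounds the absolute sums; in particular [z]
    is weakly null. *)
Let sum_dual_le g m : dual_ball g -> \sum_(k < m) `|g (z k)| <= b.
Proof.
move=> gB; have : `|\sum_(k < m) Num.sg (g (z k)) *: z k| <= b.
  by apply: (zb m (c := fun k => Num.sg (g (z k)))) => k; rewrite normr_sg lern1 leq_b1.
apply: le_trans; apply: le_trans (dual_ball_le gB _); rewrite (dual_ball_sum gB).
by apply: ler_sum => k _; rewrite (dual_ballZ gB) -normrEsg.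
Qed.

Let dual_small g (e : R) : dual_ball g -> 0 < e ->
  exists N, forall k, (N <= k)%N -> `|g (z k)| <= e.
Proof.
move=> gB e0; pose s : R^nat := series (fun k => `|g (z k)| : R^o).
have cv : cvgn s.
  apply: nondecreasing_is_cvgn.
    by apply/nondecreasing_seqP => n; rewrite /s /series /= big_nat_recr //= lerDl.
  by exists b => _ [n _ <-]; rewrite /s /series /= big_mkord; exact: sum_dual_le.
have [N _ hN] : \forall k \near \oo, `| (`|g (z k)| : R^o) | <= e.
  exact: cvgr0_norm_le (cvg_series_cvg_0 cv) _ e0.
by exists N => k Nk; have := hN k Nk; rewrite /= normr_id.
Qed.

(** Norming functionals [g_ k] may stay large on earlier vectors, so a weak* cluster point [g] is
    subtracted. The differences [h k] can then be made small on earlier [z l] by clustering, and on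
    later ones because [z] is weakly null. *)
Lemma c0_equiv_subsequence : (forall k, 2^-1 <= `|z k|) ->
  exists kappa : nat -> nat, (forall k, (kappa k < kappa k.+1)%N) /\
    equiv_c0_basis (z \o kappa).
Proof.
move=> z2.
have /choice[g_ hg_] : forall k, exists g, dual_ball g /\ g (z k) = `|z k|.
  by move=> k; have [g ? ?] := norming_functional (z k); exists g.
have gB_ k := (hg_ k).1.
have [g gB hg] := dual_ball_cluster gB_.
pose h k v := g_ k v - g v.
have sel (s : seq nat) : exists k, [/\ forall l, l \in s -> (l < k)%N,
    `|g (z k)| <= 8^-1,
    forall l, l \in s -> `|h l (z k)| <= 2^-1 ^+ size s / 32 &
    forall l, l \in s -> `|h k (z l)| <= 16^-1 / (size s).+1%:R].
  pose e : R := 2^-1 ^+ size s / 64.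
  have e0 : 0 < e by rewrite divr_gt0.
  have [N0 hN0] := dual_small gB (ltac:(lra) : 0 < 8^-1 :> R).
  have [N1 hN1] := dual_small gB e0.
  have /choice[N hN] := fun l => dual_small (gB_ l) e0.
  have [k] := hg (map z s) (16^-1 / (size s).+1%:R)
    (maxn (maxn N0 N1) (maxn (\max_(l <- s) N l) (\max_(l <- s) l.+1)))
    ltac:(by rewrite divr_gt0 // invr_gt0).
  rewrite !geq_max => /andP[/andP[kN0 kN1] /andP[kN ks]] hk; exists k; split.
  - move=> l ls; apply: leq_trans ks.
    exact: (@leq_bigmax_seq _ s xpredT succn l).
  - exact: hN0.
  - move=> l ls; have h1 := hN1 k kN1.
    have h2 : `|g_ l (z k)| <= e.
      by apply: hN; apply: leq_trans kN; exact: (@leq_bigmax_seq _ s xpredT N l).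
    apply: le_trans (ler_normB _ _) _; apply: le_trans (lerD h2 h1) _.
    by rewrite /e; lra.
  - by move=> l ls; apply: hk; exact: map_f.
have [kappa hk] := dependent_selection sel.
have mem k n : (k < n)%N -> kappa k \in mkseq kappa n.
  by move=> kn; apply/mapP; exists k => //; rewrite mem_iota.
have kS k : (kappa k < kappa k.+1)%N by have [h1 _ _ _] := hk k.+1; apply: h1; exact: mem.
exists kappa; split => //.
have b0 : 0 <= b by apply: le_trans (sum_dual_le 0 gB); rewrite big_ord0.
(* The off-diagonal terms total at most [mu / 8] and the diagonal is at least [1/2 - 1/8], so
   [3/8 * mu <= 2 * |S| + mu / 8], that is [mu <= 8 * |S|]. The extra [1] makes the upper constant
   positive. *)
exists 8^-1, (b + 1); split; [by rewrite invr_gt0|split; [lra|]].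
move=> m c; set mu := \big[Num.max/0]_(k < m) `|c k|.
have mu0 : 0 <= mu by exact: bigmax_ge_id.
have cmu k : (k < m)%N -> `|c k| <= mu.
  by move=> km; exact: (le_bigmax (0 : R) (fun k : 'I_m => `|c k|) (Ordinal km)).
set S := \sum_(k < m) _; split; last first.
  have [f fB fS] := norming_functional S.
  rewrite -fS (dual_ball_sum fB).
  apply: (@le_trans _ _ (\sum_(k < m) mu * `|f (z (kappa k))|)).
    apply: ler_sum => k _; rewrite (dual_ballZ fB); apply: le_trans (ler_norm _) _.
    by rewrite normrM; apply: ler_wpM2r => //; exact: cmu.
  rewrite -mulr_sumr mulrC; apply: ler_wpM2r => //.
  apply: (@le_trans _ _ b); last by lra.
  apply: le_trans (sum_dual_le (kappa m) fB).
  rewrite -(big_mkord predT (fun k => `|f (z k)|)).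
  rewrite -(big_mkord predT (fun k => `|f (z (kappa k))|)).
  rewrite -(big_map kappa predT (fun k => `|f (z k)|)).
  apply: ler_sum_uniq => //.
  - rewrite map_inj_uniq ?iota_uniq // => i j ij.
    case: (ltngtP i j) => // /(ltn_homo_of_succ kS); by rewrite ij ltnn.
  - exact: iota_uniq.
  - move=> _ /mapP[j + ->]; rewrite !mem_index_iota /= => jm.
    exact: (ltn_homo_of_succ kS).
have row k : (k < m)%N -> `|c k| * (3 / 8) <= 2 * `|S| + mu / 8.
  move=> km; have [_ gk _ hearly] := hk k; rewrite size_mkseq in hearly.
  have hS : `|h (kappa k) S| <= 2 * `|S|.
    apply: le_trans (ler_normB _ _) _.
    by have := (gB_ (kappa k)).2 S; have := gB.2 S; lra.
  have hsum : h (kappa k) S = \sum_(j < m) c j * h (kappa k) (z (kappa j)).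
    rewrite /h (dual_ball_sum gB) (dual_ball_sum (gB_ _)) -sumrB.
    by apply: eq_bigr => j _; rewrite (dual_ballZ gB) (dual_ballZ (gB_ _)) mulrBr.
  have diag : 3 / 8 <= `|h (kappa k) (z (kappa k))|.
    have hh := ler_normB (h (kappa k) (z (kappa k))) (- g (z (kappa k))).
    rewrite /h opprK subrK normrN (hg_ _).2 normr_id in hh.
    by rewrite /h (hg_ _).2; have := z2 (kappa k); lra.
  pose km_ := Ordinal km.
  have off : `|\sum_(j < m | j != km_) c j * h (kappa k) (z (kappa j))| <= mu / 8.
    apply: le_trans (ler_norm_sum _ _ _) _.
    apply: (@le_trans _ _ (\sum_(j < m) mu *
        ((if (j < k)%N then 16^-1 / k.+1%:R else 0) + 2^-1 ^+ j / 32))).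
      rewrite big_mkcond; apply: ler_sum => j _.
      have jj : 0 <= 2^-1 ^+ j / 32 :> R by rewrite divr_ge0.
      have kk : 0 <= 16^-1 / k.+1%:R :> R by rewrite divr_ge0.
      case: ifP => [|_]; last by rewrite mulr_ge0 // addr_ge0 //; case: ifP.
      rewrite -val_eqE /= neq_ltn => jk; rewrite normrM.
      apply: ler_pM => //; first exact: cmu.
      case: ifP jk => [jk _|_ /= kj].
        by apply: le_trans (hearly _ (mem _ _ jk)) _; rewrite lerDl.
      rewrite add0r; have [_ _ hlate _] := hk j; rewrite size_mkseq in hlate.
      exact: hlate (mem _ _ kj).
    rewrite -mulr_sumr; apply: ler_wpM2l => //; rewrite big_split /=.
    have h1 : \sum_(j < m) (if (j < k)%N then 16^-1 / k.+1%:R else 0) <= 16^-1 :> R.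
      have -> (w : R) : \sum_(j < m) (if (j < k)%N then w else 0) = \sum_(j < k) w.
        by rewrite [RHS](big_ord_widen m (fun=> w)) 1?ltnW // [RHS]big_mkcond.
      rewrite sumr_const card_ord -[_ *+ _]mulr_natr mulrAC ler_pdivrMr //.
      by rewrite ler_pM2l ?invr_gt0 // ler_nat.
    have h2 : \sum_(j < m) (2^-1 ^+ j / 32) <= 16^-1 :> R.
      rewrite -mulr_suml -(big_mkord predT (fun j => 2^-1 ^+ j)).
      have := @sum_half_pow_le R (index_iota 0 m) 0 (iota_uniq _ _) (fun=> fun=> isT).
      by rewrite expr0; lra.
    by apply: le_trans (lerD h1 h2) _; lra.
  rewrite hsum (bigD1 km_) //= in hS.
  have := ler_normB (c k * h (kappa k) (z (kappa k)) +
    \sum_(j < m | j != km_) c j * h (kappa k) (z (kappa j)))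
    (\sum_(j < m | j != km_) c j * h (kappa k) (z (kappa j))).
  rewrite addrK normrM => hh.
  have := ler_wpM2l (normr_ge0 (c k)) diag; lra.
suff : mu <= 8 / 3 * (2 * `|S| + mu / 8) by lra.
apply: bigmax_le => [|k _].
  by have := normr_ge0 S; lra.
by have := row k (ltn_ord k); lra.
Qed.

End C0.

(** At a norming functional [g] the indices split by the sign of [g (u j)], and each group is a
    plain sum bounded by [M]. *)
Lemma bounded_sums_upper_c0 (R : realType) (Y : normedModType R) (u : nat -> Y)
    (M : R) (m0 : nat) :
  (forall F, uniq F -> (forall j, j \in F -> (m0 <= j)%N) -> `|\sum_(j <- F) u j| <= M) ->
  forall m (c : nat -> R), (forall k, `|c k| <= 1) ->
    `|\sum_(k < m) c k *: u (m0 + k)%N| <= M + M.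
Proof.
move=> uM m c c1; set S := \sum_(k < m) _.
have [g gB gS] := norming_functional S.
rewrite -gS (dual_ball_sum gB).
apply: (@le_trans _ _ (\sum_(k < m) `|g (u (m0 + k)%N)|)).
  apply: ler_sum => k _; rewrite (dual_ballZ gB); apply: le_trans (ler_norm _) _.
  by rewrite normrM ler_piMl.
have -> : \sum_(k < m) `|g (u (m0 + k)%N)| = \sum_(j <- iota m0 m) `|g (u j)|.
  rewrite -(big_mkord predT (fun k => `|g (u (m0 + k)%N)|)) /index_iota subn0.
  by rewrite -[in RHS](addn0 m0) iotaDl big_map.
rewrite (bigID (fun j => 0 <= g (u j))) /=; apply: lerD.
  rewrite (eq_bigr (fun j => g (u j))); last by move=> j; exact: ger0_norm.
  rewrite -(dual_ball_sum gB) -big_filter; apply: le_trans (dual_ball_le gB _) _.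
  apply: uM; first by rewrite filter_uniq ?iota_uniq.
  by move=> j; rewrite mem_filter mem_iota => /and3P[].
rewrite (eq_bigr (fun j => - g (u j))); last first.
  by move=> j; rewrite -ltNge => /ltr0_norm.
rewrite sumrN -(dual_ball_sum gB) -(dual_ballN gB) -big_filter.
apply: le_trans (dual_ball_le gB _) _; rewrite normrN.
apply: uM; first by rewrite filter_uniq ?iota_uniq.
by move=> j; rewrite mem_filter mem_iota => /and3P[].
Qed.

(** * Block sequences of averages *)

Section Blocks.
Variables (R : realType) (Y : normedModType R).

Lemma blocks_lt (F : nat -> seq nat) : (forall k, F k != [::]) ->
  (forall k i j, i \in F k -> j \in F k.+1 -> (i < j)%N) ->
  forall k l i j, (k < l)%N -> i \in F k -> j \in F l -> (i < j)%N.
Proof.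
move=> F0 FS k l i j + iF; elim: l j => // l IH j.
rewrite ltnS leq_eqVlt => /predU1P[<-|kl] jF; first exact: FS jF.
have : exists j', j' \in F l by case: (F l) (F0 l) => // a s _; exists a; rewrite inE eqxx.
by move=> [j' j'F]; apply: ltn_trans (IH j' kl j'F) _; exact: FS jF.
Qed.

Lemma block_averages_sub (y z : nat -> Y) (th kappa : nat -> nat) :
  (forall k, (th k < th k.+1)%N) -> (forall k, (kappa k < kappa k.+1)%N) ->
  block_basis_of_1_averages (y \o th) z -> block_basis_of_1_averages y (z \o kappa).
Proof.
move=> /ltn_homo_of_succ thS kS [lam [F [lam0 [F0 [FS zE]]]]].
exists (lam \o kappa), (fun k => map th (F (kappa k))); split; first by move=> k; exact: lam0.
split.
  move=> k; have [Fk0 Fku] := F0 (kappa k); split; first by case: (F _) Fk0.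
  rewrite map_inj_uniq // => i j ij; case: (ltngtP i j) => // /thS; by rewrite ij ltnn.
split; last by move=> k /=; rewrite zE big_map.
move=> k _ _ /mapP[i iF ->] /mapP[j jF ->]; apply: thS.
exact: (blocks_lt (fun k => (F0 k).1) FS (kS k)) iF jF.
Qed.

Variables (t : nat -> Y) (C K : R).
Hypothesis tC : forall n x B, schreier_le x B -> `|synth t n x| <= C * B.
Local Notation T := (synth t).

(* The lifts [x_k] are blocks whose sup norm is at most [1 / min supp x_k], so an
   admissible set that meets one block cannot see more than [1] in all later ones. *)
Lemma flat_averages_upper_c0 (u : nat -> Y) :
  (forall (q : nat) (a e : R), 0 < a -> 0 < e ->
   exists F lam q' x, [/\ [/\ F != [::], uniq F &
      forall j, j \in F -> (q <= j < q')%N],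
    0 < lam /\ 2^-1 <= `|lam *: \sum_(j <- F) u j|,
    (q <= q')%N /\ (forall i, (i < q)%N || (q' <= i)%N -> x i = 0),
    schreier_le x K /\ forall i, `|x i| <= a &
    `|lam *: \sum_(j <- F) u j - T q' x| <= e]) ->
  exists z b, [/\ block_basis_of_1_averages u z, forall k, 2^-1 <= `|z k| &
    forall m (c : nat -> R), (forall k, `|c k| <= 1) -> `|\sum_(k < m) c k *: z k| <= b].
Proof.
move=> flat.
pose A := ((seq nat * R) * (nat * (nat -> R)))%type.
(* The end of the last chosen block, or [0] at the start; it sets both the next support and the next
   flatness bound. *)
pose qs (s : seq A) := last 0%N (map (fun a : A => a.2.1) s).
pose good (s : seq A) (a : A) :=
  let F := a.1.1 in let lam := a.1.2 in let q := qs s in let q' := a.2.1 in let x := a.2.2 in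
  [/\ [/\ F != [::], uniq F & forall j, j \in F -> (q <= j < q')%N],
    0 < lam /\ 2^-1 <= `|lam *: \sum_(j <- F) u j|,
    (q <= q')%N /\ (forall i, (i < q)%N || (q' <= i)%N -> x i = 0),
    schreier_le x K /\ forall i, `|x i| <= q.+1%:R^-1 &
    `|lam *: \sum_(j <- F) u j - T q' x| <= 2^-1 ^+ size s].
have /dependent_selection[a ha] : forall s, exists a, good s a.
  move=> s; have [||F [lam [q' [x h]]]] := flat (qs s) (qs s).+1%:R^-1 (2^-1 ^+ size s).
  - by rewrite invr_gt0.
  - by [].
  by exists ((F, lam), (q', x)).
pose p k := qs (mkseq a k).
have pS k : p k.+1 = (a k).2.1 by rewrite /p /qs mkseqS map_rcons last_rcons.
pose z k := (a k).1.2 *: \sum_(j <- (a k).1.1) u j.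
(* [K + 1] bounds the glued lifts, and [2] bounds the sum of the lifting errors [2^-k]. *)
exists z, (C * (K + 1) + 2); split.
- exists (fun k => (a k).1.2), (fun k => (a k).1.1); split.
    by move=> k; have [_ []] := ha k.
  split; first by move=> k; have [[]] := ha k.
  split=> // k i j; have [[_ _ h1] _ _ _ _] := ha k; have [[_ _ h2] _ _ _ _] := ha k.+1.
  by move=> /h1/andP[_ ip] /h2/andP[pj _]; apply: leq_trans ip _; rewrite -pS.
- by move=> k; have [_ []] := ha k.
move=> m c c1.
have p_le k : (p k <= p k.+1)%N by rewrite pS; have [_ _ []] := ha k.
have p_homo : {homo p : i j / (i <= j)%N}.
  by apply: homo_leq => // ? ? ?; exact: leq_trans.
have supp k i : (i < p k)%N || (p k.+1 <= i)%N -> (a k).2.2 i = 0.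
  by rewrite pS; have [_ _ [_ h] _ _] := ha k; exact: h.
have := @schreier_le_blocks R p (fun k => (a k).2.2) c K m p_le supp.
have sup k i : (p k)%:R * `|(a k).2.2 i| <= 1.
  have [_ _ _ [_ /(_ i) h] _] := ha k; rewrite -/(p k) in h.
  apply: (@le_trans _ _ ((p k).+1%:R * `|(a k).2.2 i|)).
    by rewrite ler_wpM2r // ler_nat.
  by rewrite -ler_pdivlMl // mulr1.
move=> /(_ sup (fun k => let: And5 _ _ _ h _ := ha k in h.1) c1) /(tC (p m)) hT.
have TE : T (p m) (fun i => \sum_(k < m) c k * (a k).2.2 i) =
    \sum_(k < m) c k *: T (p k.+1) (a k).2.2.
  rewrite synth_sum; apply: eq_bigr => k _; rewrite synthZ; congr (_ *: _).
  by apply: synth_widen => [|i h]; [exact: p_homo|apply: supp; rewrite h orbT].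
rewrite TE in hT.
have err : `|\sum_(k < m) c k *: (z k - T (p k.+1) (a k).2.2)| <= 2.
  apply: le_trans (ler_norm_sum _ _ _) _.
  apply: (@le_trans _ _ (\sum_(k < m) 2^-1 ^+ k)).
    apply: ler_sum => k _; rewrite normrZ.
    have [_ _ _ _ h] := ha k; rewrite size_mkseq -pS in h.
    by apply: le_trans h; rewrite ler_piMl.
  rewrite -(big_mkord predT (fun j => 2^-1 ^+ j)).
  have := @sum_half_pow_le R (index_iota 0 m) 0 (iota_uniq _ _) (fun=> fun=> isT).
  by rewrite expr0 mulr1.
apply: le_trans (lerD hT err); apply: le_trans (ler_normD _ _).
rewrite -big_split /= le_eqVlt; apply/orP; left; apply/eqP; congr `| _ |.
by apply: eq_bigr => k _; rewrite -scalerDr addrC subrK.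
Qed.

End Blocks.

(** * The dichotomy between bounded and unbounded sums *)

Theorem mainTheorem3 (R : realType) (Y : completeNormedModType R) :
  quotient_of_schreier Y -> property_S1 Y.
Proof.
move=> [T Tq] y y1 yw.
have [t [C [K [K0 tC tK]]]] := schreier_quotient_frame Tq.
have [io [ioS iow]] := uniformly_weakly_null_subsequence K0 tC tK yw.
(* The radius is [K] because the averages to be lifted are scaled to norm one. *)
have [||p [pS cut]] := @cut_lift_subsequence R Y t C tC (y \o io) K (fun k => 2^-1 ^+ k) iow.
- by move=> j; rewrite /= y1.
- by move=> k; exact: half_pow_gt0.
pose u := y \o (io \o p).
have thS k : ((io \o p) k < (io \o p) k.+1)%N.
  exact: (ltn_homo_of_succ ioS (pS k)).
have u1 j : `|u j| <= 1 by rewrite /u /= y1.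
suff [z [b [zblock z2 zb]]] : exists z b,
    [/\ block_basis_of_1_averages u z, forall k, 2^-1 <= `|z k| &
    forall m (c : nat -> R), (forall k, `|c k| <= 1) -> `|\sum_(k < m) c k *: z k| <= b].
  have [kappa [kS zk]] := c0_equiv_subsequence zb z2.
  by exists (z \o kappa); split => //; exact: block_averages_sub zblock.
have [[M [m0 uM]]|unb] := pselect (exists M m0, forall F, uniq F ->
    (forall j, j \in F -> (m0 <= j)%N) -> `|\sum_(j <- F) u j| <= M).
  (* With bounded sums the averages are single terms with [lam = 1]. *)
  exists (fun k => u (m0 + k)%N), (M + M); split; last exact: bounded_sums_upper_c0.
    exists (fun=> 1), (fun k => [:: (m0 + k)%N]); split=> //; split=> //; split.
      by move=> k i j; rewrite !inE => /eqP-> /eqP->; rewrite addnS.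
    by move=> k; rewrite big_seq1 scale1r.
  by move=> k; rewrite /u /= y1 invf_le1 // ler1n.
apply: (flat_averages_upper_c0 tC) => q a e a0 e0.
apply: (flat_average tK u1 pS cut q a0 e0 (ltW K0)) => M m0.
apply: contrapT => H; apply: unb; exists M, m0 => F uF Fm0.
by rewrite leNgt; apply/negP => MF; apply: H; exists F.
Qed.
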